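(* Assume $p\ge 5$. For $j\ge 1$ put $a_j=(p-2)(p-4)\cdots(p-2j)$ and $b_j=m(m+2)\cdots(m+2j-2)$. Let $\ell$ be a fixed natural number ($\ell\ge 1$) with $\ell<(p-2)/2$, and let $\phi$ be a real function on $(0,\infty)$ such that $$0\le \phi(t)\le 2\sum_{j=1}^{\ell}\frac{a_j}{b_j}\,t^{-j}\qquad\text{for all } t>0 .$$ Let $$\hat\beta^{LS}=\frac{U^tZ}{\|U\|^2},\qquad \hat\beta_\phi=\Big\{1+\phi\Big(\frac{\|U\|^2}{S}\Big)\Big\}\hat\beta^{LS}.$$ Then $|\mathrm{Bias}(\hat\beta_\phi;\beta)|\le|\mathrm{Bias}(\hat\beta^{LS};\beta)|$ for any $\beta$ (and any value of the other parameters).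
   Context: Model: $Z,U$ are $p$-dimensional random vectors and $S$ is a positive random variable, mutually independent, with $Z\sim N_p(\beta\xi,\tau^2I_p)$, $U\sim N_p(\xi,\sigma^2I_p)$, $S\sim\sigma^2\chi^2_m$. The parameters $\beta\in\mathbb{R}$, $\xi\in\mathbb{R}^p\setminus\{0\}$, $\sigma^2>0$, $\tau^2>0$ are unknown. Here $p=n-1$ and $m=n(r-1)$ for integers $n\ge2$, $r\ge2$. $\|\cdot\|$ is the Euclidean norm and $^t$ denotes transpose. For an estimator $\hat\beta$ of $\beta$, $\mathrm{Bias}(\hat\beta;\beta)=E[\hat\beta]-\beta$, with expectation under the model. Functions are understood to be Borel measurable. *)

(* Defs.v *)
From HB Require Import structures.
From mathcomp Require Import all_boot all_order all_algebra.
From mathcomp Require Import all_classical all_reals all_analysis.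

Set Implicit Arguments.
Unset Strict Implicit.
Unset Printing Implicit Defensive.

Import Order.TTheory GRing.Theory Num.Theory.
Import numFieldNormedType.Exports.

Local Open Scope classical_set_scope.
Local Open Scope ring_scope.

(* Random vectors take values in p.-tuple R, which carries the product
   (= Borel) sigma-algebra; deterministic parameter vectors are in 'rV[R]_p. *)

Definition dotp (R : realType) (p : nat) (x y : p.-tuple R) : R :=
  \sum_(i < p) tnth x i * tnth y i.

Definition sqnorm (R : realType) (p : nat) (x : p.-tuple R) : R := dotp x x.

(* X ~ N_p(mu, s2 I_p): the joint density is the product of the one-dimensional
   N(mu_i, s2) densities, stated on measurable boxes, which determine the law.
   normal_prob takes the standard deviation as its second argument. *)
Definition isotropic_normal (d : measure_display) (T : measurableType d)
    (R : realType) (P : probability T R) (p : nat)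
    (X : {RV P >-> p.-tuple R}) (mu : 'rV[R]_p) (s2 : R) : Prop :=
  forall A : 'I_p -> set R, (forall i, measurable (A i)) ->
    distribution P X [set x : p.-tuple R | forall i, A i (tnth x i)] =
    (\prod_(i < p) normal_prob (mu ord0 i) (Num.sqrt s2) (A i))%E.

Definition Gamma (R : realType) (a : R) : R :=
  \int[@lebesgue_measure R]_(x in `]0, +oo[) (x `^ (a - 1) * expR (- x)).

Definition chi2_pdf (R : realType) (m : nat) (x : R) : R :=
  x `^ (m%:R / 2 - 1) * expR (- x / 2) / (2 `^ (m%:R / 2) * Gamma (m%:R / 2)).

Definition chi2_prob (R : realType) (m : nat) (A : set R) : \bar R :=
  (\int[@lebesgue_measure R]_(x in A `&` `]0%R, +oo[) (chi2_pdf m x)%:E)%E.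

(* X ~ c chi^2_m *)
Definition scaled_chi2 (d : measure_display) (T : measurableType d)
    (R : realType) (P : probability T R)
    (X : {RV P >-> R}) (c : R) (m : nat) : Prop :=
  forall A : set R, measurable A ->
    P [set w | A (X w / c)] = chi2_prob m A.

(* The sets A, B, C may be the full spaces, so the product rule for all
   subfamilies is included. *)
Definition mutually_independent3 (d d1 d2 d3 : measure_display)
    (T : measurableType d) (T1 : measurableType d1) (T2 : measurableType d2)
    (T3 : measurableType d3) (R : realType) (P : probability T R)
    (X : {RV P >-> T1}) (Y : {RV P >-> T2}) (W : {RV P >-> T3}) : Prop :=
  forall (A : set T1) (B : set T2) (C : set T3),
    measurable A -> measurable B -> measurable C ->
    P (X @^-1` A `&` Y @^-1` B `&` W @^-1` C) =
    (P (X @^-1` A) * P (Y @^-1` B) * P (W @^-1` C))%E.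

(* On the null event U = 0 the estimators take the value 0, by the convention
   x / 0 = 0. *)
Definition beta_LS (R : realType) (T : Type) (p : nat)
    (Z U : T -> p.-tuple R) (w : T) : R :=
  dotp (U w) (Z w) / sqnorm (U w).

Definition beta_phi (R : realType) (T : Type) (p : nat) (phi : R -> R)
    (Z U : T -> p.-tuple R) (S : T -> R) (w : T) : R :=
  (1 + phi (sqnorm (U w) / S w)) * beta_LS Z U w.

Definition Bias (d : measure_display) (T : measurableType d) (R : realType)
    (P : probability T R) (X : T -> R) (beta : R) : \bar R :=
  ('E_P[X] - beta%:E)%E.

(* (p-2)(p-4)...(p-2j), in R so that no subtraction is truncated. *)
Definition coef_a (R : realType) (p j : nat) : R :=
  \prod_(1 <= i < j.+1) (p%:R - (2 * i)%:R).

(* m(m+2)...(m+2j-2) *)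
Definition coef_b (R : realType) (m j : nat) : R :=
  \prod_(0 <= i < j) (m + 2 * i)%:R.

(* Main.v *)
Require Import Defs.
From HB Require Import structures.
From mathcomp Require Import all_boot all_order all_algebra.
From mathcomp Require Import all_classical all_reals all_analysis.
From mathcomp Require Import measurable_realfun.
From mathcomp Require Import ring lra.

Set Implicit Arguments.
Unset Strict Implicit.
Unset Printing Implicit Defensive.

Import Order.TTheory GRing.Theory Num.Theory.
Import numFieldNormedType.Exports.

Local Open Scope classical_set_scope.
Local Open Scope ring_scope.

(** Write N = |U|^2, L = <xi, U>, s = sigma2, g_k = E[N^-k] and
    h_k = E[L N^-k]. Since Z is independent of (U, S) and has mean beta xi, the
    two biases are beta (h_1 - 1) and beta (h_1 - 1 + X), where
    X = E[phi(N/S) L/N]. The claim is therefore 0 <= X <= 2 (1 - h_1)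
    ([correction_bounds]).

    The reflection u -> -u multiplies the density of U by exp(-2 L/s), so that
    E[f L] = E[f L^+ (1 - exp(-2 L/s))] >= 0 for every nonnegative f that is
    even in U ([even_inner_indep_ge0]). With f = phi(N/S)/N this gives X >= 0.
    With f = (bound(N/S) - phi(N/S))/N it allows phi to be replaced by its
    bound; as U and S are independent and E[S^j] <= s^j b_j
    ([scaled_chi2_moment_le]), the upper estimate becomes
      h_1 + sum_(1 <= j <= l) a_j s^j h_(j+1) <= 1.
    It follows from Stein's inequality ([stein_le])
      h_(k+1) <= g_k - (p - 2k - 2) s g_(k+1):
    because a_(k+1) = a_k (p - 2k - 2), the sum telescopes to
    1 - a_(l+1) s^(l+1) g_(l+1), and a_(l+1) >= 0 since 2(l+1) < p.

    Stein's inequality is obtained by dilation instead of integration by parts.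
    Passing from u to c u multiplies the density of N_p(xi, s I) by
    |c|^p exp(-((c^2-1) N - 2(c-1) L)/(2s)) ([isotropic_normal_scaling]).
    For c = 1 + e, the bound exp x >= 1 + x and the limit e -> 0 yield the
    one-sided inequality, which suffices for an upper estimate. The argument
    applies to the bounded functions (N + delta)^-k first; it then bounds their
    means uniformly in delta by induction on k, so that N^-k is integrable as
    soon as 2k < p ([invpow_integrable]), and delta = 0 becomes admissible.
    The reflection above is the case c = -1, and dilations also give the moments
    of chi-square laws and the integrability of one normal coordinate. *)

(** * Measures with a density and their images *)

Section density.
Context d (T : measurableType d) (R : realType).
Variables (mu : {measure set T -> \bar R}) (w : T -> R).
Hypotheses (mw : measurable_fun setT w) (w0 : forall x, 0 <= w x).
Local Open Scope ereal_scope.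

Import HBNNSimple.

Let dens (A : set T) := \int[mu]_(x in A) (w x)%:E.

Let dens0 : dens set0 = 0. Proof. by rewrite /dens integral_set0. Qed.

Let dens_ge0 A : 0 <= dens A.
Proof. by apply: integral_ge0 => x _; rewrite lee_fin. Qed.

Let dens_sigma_additive : semi_sigma_additive dens.
Proof.
move=> F mF tF mUF; rewrite /dens ge0_integral_bigcup//.
- apply: is_cvg_ereal_nneg_natsum_cond => n _ _; exact: dens_ge0.
- by apply/measurable_EFinP/measurable_funTS.
- by move=> x _; rewrite lee_fin.
Qed.

HB.instance Definition _ := isMeasure.Build _ _ _ dens
  dens0 dens_ge0 dens_sigma_additive.

(* Both sides are limits along the same nondecreasing simple functions, which
   reduces the formula to indicators, where it defines dens. *)
Let density_measure : exists nu : {measure set T -> \bar R},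
  forall f : T -> \bar R, measurable_fun setT f -> (forall x, 0 <= f x) ->
  \int[nu]_x f x = \int[mu]_x (f x * (w x)%:E).
Proof.
exists dens => f mf f0.
pose h := nnsfun_approx measurableT mf.
have hf x : (EFin \o h n) x @[n --> \oo] --> f x.
  by apply: cvg_nnsfun_approx => // y _; exact: f0.
have mwE : measurable_fun setT (fun x => (w x)%:E) by exact/measurable_EFinP.
have -> : \int[dens]_x f x = limn (fun n => \int[dens]_x (h n x)%:E).
  rewrite -monotone_convergence//.
  - by apply: eq_integral => x _; apply/esym/cvg_lim => //; exact: hf.
  - by move=> n; exact/measurable_EFinP/measurable_funP.
  - by move=> n x _; rewrite lee_fin.
  - by move=> x _ a b ab; rewrite lee_fin; exact/lefP/nd_nnsfun_approx.
have -> : \int[mu]_x (f x * (w x)%:E) =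
    limn (fun n => \int[mu]_x ((h n x)%:E * (w x)%:E)).
  rewrite -monotone_convergence//.
  - apply: eq_integral => x _; apply/esym/cvg_lim => //.
    by apply: cvgeZr => //; exact: hf.
  - move=> n; apply: emeasurable_funM => //.
    exact/measurable_EFinP/measurable_funP.
  - by move=> n x _; rewrite mule_ge0 ?lee_fin.
  - move=> x _ a b ab; rewrite lee_wpmul2r ?lee_fin//.
    exact/lefP/nd_nnsfun_approx.
suff dE n : \int[dens]_x (h n x)%:E = \int[mu]_x ((h n x)%:E * (w x)%:E).
  by congr (limn _); apply/funext.
rewrite integralT_nnsfun sintegralE.
under [RHS]eq_integral => x _.
  rewrite fimfunE -fsumEFin// ge0_mule_fsuml; last first.
    by move=> y; exact: nnfun_muleindic_ge0.
  over.
rewrite ge0_integral_fsum//; last 2 first.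
- move=> y; apply: emeasurable_funM => //.
  by apply/measurable_EFinP; exact: measurable_funM.
- by move=> y x _; apply: mule_ge0; [exact: nnfun_muleindic_ge0|rewrite lee_fin].
apply: eq_fsbigr => r rhn.
under [RHS]eq_integral do rewrite EFinM -muleA.
rewrite ge0_integralZl//; last 3 first.
- apply: emeasurable_funM => //.
  by apply/measurable_EFinP.
- by move=> x _; rewrite mule_ge0 ?lee_fin.
- by move: rhn; rewrite inE => -[t _ <-]; rewrite lee_fin.
congr (_ * _); rewrite -[LHS]/(\int[mu]_(x in h n @^-1` [set r]) (w x)%:E).
rewrite integral_mkcond.
by apply: eq_integral => x _; rewrite epatch_indic muleC.
Qed.

(** A change of variables with a Jacobian or a likelihood ratio is the equality
    of a given measure with such an image; the latter can then be compared with
    the former on a generating family of sets. *)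
Lemma weighted_pushforward d' (T' : measurableType d') (phi : T -> T') :
  measurable_fun setT phi -> exists nu : {measure set T' -> \bar R},
  forall f : T' -> \bar R, measurable_fun setT f -> (forall x, 0 <= f x) ->
  \int[nu]_x f x = \int[mu]_x (f (phi x) * (w x)%:E).
Proof.
move=> mphi; have [nu nuE] := density_measure.
unshelve (exists (pushforward nu phi)); first exact: mphi.
move=> f mf f0; rewrite ge0_integral_pushforward//.
by rewrite nuE//; [exact: measurableT_comp|move=> x; exact: f0].
Qed.

End density.

(** The image of |c| times Lebesgue measure under x -> c x + b has the right mass
    on half-open intervals. The offset serves the reflection about the mean of a
    normal law. *)
Lemma ge0_integral_affine (R : realType) (c b : R) (f : R -> \bar R) :
  c != 0 -> measurable_fun setT f -> (forall x, 0 <= f x)%E ->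
  (\int[@lebesgue_measure R]_x f x =
   `|c|%:E * \int[@lebesgue_measure R]_x f (c * x + b)%R)%E.
Proof.
move=> c0 mf f0; pose phi := fun x : measurableTypeR R => c * x + b : measurableTypeR R.
have mphi : measurable_fun setT phi.
  by apply: measurable_funD => //; exact: measurable_funM.
have mk : measurable_fun setT (cst `|c| : measurableTypeR R -> R).
  exact: measurable_cst.
have [nu nuE] := @weighted_pushforward _ _ R (@lebesgue_measure R) (cst `|c|) mk
  (fun=> normr_ge0 c) _ _ _ mphi.
have nuA : forall A, measurable A -> (@lebesgue_measure R) A = nu A.
  apply: lebesgue_measure_unique => X [[u v] _ <-]/=.
  transitivity (\int[nu]_x (\1_(`]u, v]%classic : set R) x)%:E)%E; last first.
    by rewrite integral_indic// setIT.
  rewrite nuE//; last by apply/measurable_EFinP; exact: measurable_indic.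
  under [RHS]eq_integral do rewrite muleC /=.
  have mpX : measurable (phi @^-1` `]u, v]%classic).
    by rewrite -[X in measurable X]setTI; exact: mphi.
  rewrite ge0_integralZl//; last first.
    by apply/measurable_EFinP; apply: measurable_indic; exact: mpX.
  rewrite -[X in (_ * integral _ _ X)%E]/(fun x => (\1_(phi @^-1` `]u, v]%classic) x)%:E).
  rewrite integral_indic//.
  rewrite setIT.
  change (lebesgue_measure `]u, v]%classic =
    `|c|%:E * (@lebesgue_measure R) (phi @^-1` `]u, v]))%E.
  have [c1|c1] := ltP 0 c.
    have -> : phi @^-1` `]u, v]%classic = (`](u - b) / c, (v - b) / c]%classic : set R).
      apply/seteqP; split => x; rewrite /phi/= !in_itv/=.
        by rewrite ltr_pdivrMr// ler_pdivlMr// ltrBlDr lerBrDr mulrC.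
      by rewrite ltr_pdivrMr// ler_pdivlMr// ltrBlDr lerBrDr mulrC.
    rewrite !lebesgue_measure_itv/= !lte_fin.
    rewrite ltr_pM2r ?invr_gt0// ltrD2r.
    case: ifP => _; last by rewrite mule0.
    by rewrite -!EFinB -EFinM; congr EFin; rewrite gtr0_norm//; field.
  have {}c1 : c < 0 by rewrite lt_neqAle c0.
  have -> : phi @^-1` `]u, v]%classic = (`[(v - b) / c, (u - b) / c[%classic : set R).
    apply/seteqP; split => x; rewrite /phi/= !in_itv/=.
      by rewrite ltr_ndivlMr// ler_ndivrMr// ltrBlDr lerBrDr mulrC andbC.
    by rewrite ltr_ndivlMr// ler_ndivrMr// ltrBlDr lerBrDr mulrC andbC.
  rewrite (lebesgue_measure_itv `]u, v]) !lebesgue_measure_itv/= !lte_fin.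
  rewrite ltr_nM2r ?invr_lt0// ltrD2r.
  case: ifP => _; last by rewrite mule0.
  by rewrite -!EFinB -EFinM; congr EFin; rewrite ltr0_norm//; field.
transitivity (\int[nu]_x f x)%E.
  by apply: eq_measure_integral => A mA _; exact: nuA.
rewrite nuE//; under eq_integral do rewrite muleC /=.
by rewrite ge0_integralZl//; exact: measurableT_comp.
Qed.

Lemma integral_indicT d (T : measurableType d) (R : realType)
    (mu : {measure set T -> \bar R}) (A : set T) :
  measurable A -> (\int[mu]_x (\1_A x)%:E = mu A)%E.
Proof. by move=> mA; rewrite integral_indic// setIT. Qed.

(** * Products over coordinates and laws of random vectors *)

Lemma measurable_forall_ord d (T : measurableType d) p (A : 'I_p -> set T) :
  (forall i, measurable (A i)) -> measurable [set w | forall i, A i w].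
Proof.
move=> mA; rewrite (_ : [set _ | _] = \bigcap_(i in [set: 'I_p]) A i).
  by apply: fin_bigcap_measurable => [|i _ //]; exact: finite_finset.
apply/seteqP; split => w /=; first by move=> wA i _; exact: wA.
by move=> wA i; exact: wA.
Qed.

Lemma measurable_prod_fun d (T : measurableType d) (R : realType) (I : Type)
    (s : seq I) (Q : pred I) (h : I -> T -> R) :
  (forall i, measurable_fun setT (h i)) ->
  measurable_fun setT (fun x => \prod_(i <- s | Q i) h i x).
Proof.
move=> mh; elim: s => [|i s IH].
  by under eq_fun do rewrite big_nil; exact: measurable_cst.
under eq_fun do rewrite big_cons; case: (Q i) => //.
exact: measurable_funM.
Qed.

(** Indicators are replaced by arbitrary functions one coordinate at a time: with
    all the other factors fixed, both sides are measures in the remaining set,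
    hence they agree on functions of that coordinate. *)
Lemma ge0_integral_prod d (T : measurableType d) (R : realType)
    (P : {measure set T -> \bar R}) p (Y : 'I_p -> T -> R)
    (mu : 'I_p -> probability (measurableTypeR R) R)
    (f : 'I_p -> R -> R) (c : 'I_p -> R) :
  (forall i, measurable_fun setT (Y i)) ->
  (forall A : 'I_p -> set R, (forall i, measurable (A i)) ->
     P [set w | forall i, A i (Y i w)] = (\prod_i mu i (A i))%E) ->
  (forall i, measurable_fun setT (f i)) -> (forall i x, 0 <= f i x) ->
  (forall i, \int[mu i]_x (f i x)%:E = (c i)%:E)%E ->
  (\int[P]_w (\prod_i f i (Y i w))%:E = (\prod_i c i)%:E)%E.
Proof.
move=> mY PY.
(* The coordinates of index at least k still carry indicators. *)
suff step k : forall (f : 'I_p -> R -> R) (c : 'I_p -> R), (forall i : 'I_p, (k <= i)%N ->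
    exists2 A : set R, measurable A & f i = \1_A) ->
  (forall i, measurable_fun setT (f i)) -> (forall i x, 0 <= f i x) ->
  (forall i, \int[mu i]_x (f i x)%:E = (c i)%:E)%E ->
  (\int[P]_w (\prod_i f i (Y i w))%:E = (\prod_i c i)%:E)%E.
  by apply: (step p) => i; rewrite leqNgt ltn_ord.
move: {f c} k; elim=> [f c fA mf f0 fc|k IH f c fA mf f0 fc].
  have {fA} /choice[A fA] : forall i, exists A : set R, measurable A /\ f i = \1_A.
    by move=> i; have [//|A mA fiA] := fA i; exists A.
  have mA i : measurable (A i) by have [] := fA i.
  have mbox : measurable [set w | forall i, A i (Y i w)].
    apply: (measurable_forall_ord (A := fun i => Y i @^-1` A i)) => i.
    by rewrite -[X in measurable X]setTI; exact: mY.
  transitivity (\int[P]_w (\1_[set w | forall i, A i (Y i w)] w)%:E)%E.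
    apply: eq_integral => w _; congr EFin.
    under eq_bigr do rewrite (fA _).2.
    have [wA|wA] := pselect (forall i, A i (Y i w)).
      rewrite indicE mem_set// big1// => i _; rewrite indicE mem_set//.
    rewrite [RHS]indicE memNset//.
    move/existsNP : wA => [i wA].
    by rewrite (bigD1 i)//= indicE memNset// mul0r.
  rewrite integral_indic// setIT PY// -prodEFin; apply: eq_bigr => i _.
  rewrite -fc (fA i).2; apply/esym/integral_indicT; exact: (mA i).
have [pk|kp] := leqP p k.
  by apply: IH => // i ki; exfalso; move: (ltn_ord i); rewrite ltnNge (leq_trans pk ki).
pose i0 := Ordinal kp.
have c0 i : 0 <= c i by rewrite -lee_fin -fc integral_ge0// => x _; rewrite lee_fin.
pose C := \prod_(i < p | i != i0) c i.
have C0 : 0 <= C by exact: prodr_ge0.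
pose H w := \prod_(i < p | i != i0) f i (Y i w).
have mH : measurable_fun setT H.
  by apply: measurable_prod_fun => i; exact: measurableT_comp.
have H0 w : 0 <= H w by exact: prodr_ge0.
have [nu nuE] := @weighted_pushforward _ _ _ P H mH H0 _ (measurableTypeR R) _ (mY i0).
have nuA A : measurable A -> nu A = mscale (NngNum C0) (mu i0) A.
  move=> mA; transitivity (\int[nu]_x (\1_A x)%:E)%E.
    by rewrite integral_indicT.
  rewrite nuE//; last by apply/measurable_EFinP; exact: measurable_indic.
  pose f' i := if i == i0 then \1_A else f i.
  pose c' i := if i == i0 then fine (mu i0 A) else c i.
  transitivity (\int[P]_w (\prod_i f' i (Y i w))%:E)%E.
    apply: eq_integral => w _; rewrite -EFinM (bigD1 i0)//= /f' eqxx; congr (_ * _)%:E.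
    by apply: eq_bigr => i /negPf ->.
  rewrite (IH _ c'); first last.
  - move=> i; rewrite /f' /c'; case: eqP => // ->.
    rewrite integral_indicT; last exact: mA.
    by rewrite fineK//; apply: fin_num_measure; exact: mA.
  - by move=> i x; rewrite /f'; case: eqP.
  - by move=> i; rewrite /f'; case: eqP => // _; exact: measurable_indic.
  - move=> i ki; rewrite /f'; case: eqP => [_|ii0]; first by exists A.
    apply: fA; rewrite ltn_neqAle ki andbT; apply/eqP => kii; apply: ii0.
    exact: val_inj.
  rewrite (bigD1 i0)//= /c' eqxx mulrC EFinM /mscale/= fineK ?fin_num_measure//.
  congr (_%:E * _)%E; rewrite /C; apply: eq_bigr => i /negPf -> //.
transitivity (\int[nu]_x (f i0 x)%:E)%E.
  rewrite nuE//; last 2 first.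
  - by apply/measurable_EFinP; exact: (mf i0).
  - by move=> x; rewrite lee_fin.
  by apply: eq_integral => w _; rewrite -EFinM (bigD1 i0).
rewrite (eq_measure_integral (mscale (NngNum C0) (mu i0))); last first.
  by move=> A mA _; exact: nuA.
rewrite ge0_integral_mscale//; last 2 first.
- by apply/measurable_EFinP; exact: (mf i0).
- by move=> x _; rewrite lee_fin.
by rewrite fc -EFinM (bigD1 i0)//= mulrC.
Qed.

Definition box (R : realType) p (A : 'I_p -> set R) : set (p.-tuple R) :=
  [set x | forall i, A i (tnth x i)].

Lemma measurable_box (R : realType) p (A : 'I_p -> set R) :
  (forall i, measurable (A i)) -> measurable (box A).
Proof.
move=> mA; apply: (measurable_forall_ord (A := fun i => (@tnth _ _)^~ i @^-1` A i)) => i.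
by rewrite -[X in measurable X]setTI; exact: measurable_tnth.
Qed.

(** Boxes are stable under intersection and generate the product sigma-algebra. *)
Lemma tuple_measure_unique (R : realType) p
    (m1 m2 : {measure set (p.-tuple R) -> \bar R}) :
  (m1 setT < +oo)%E ->
  (forall A, (forall i, measurable (A i)) -> m1 (box A) = m2 (box A)) ->
  forall A, measurable A -> m1 A = m2 A.
Proof.
move=> m1oo m12.
pose G := [set box A | A in [set A : 'I_p -> set R | forall i, measurable (A i)]].
have GT : G setT by exists (fun=> setT) => //; apply/seteqP; split.
apply: (measure_unique G (fun=> setT)) => //.
- apply/seteqP; split; last first.
    apply: smallest_sub; first exact: sigma_algebra_measurable.
    by move=> _ [A mA <-]; exact: measurable_box.
  apply: smallest_sub; first exact: smallest_sigma_algebra.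
  apply: (big_ind (fun S : set (set (p.-tuple R)) => S `<=` <<s G >>))
    => [|X Y XG YG|k _ _ [A mA <-]]; first exact: sub0set.
    by rewrite subUset; split.
  apply: sub_sigma_algebra; exists (fun i => if i == k then A else setT).
    by move=> i /=; case: ifP.
  apply/seteqP; split => x /=.
    by move=> /(_ k); rewrite eqxx; split.
  by move=> [_ Ax] i; case: eqP => // ->.
- move=> _ _ [A mA <-] [B mB <-]; exists (fun i => A i `&` B i).
    by move=> i; exact: measurableI.
  apply/seteqP; split => x /=.
    by move=> AB; split => i; have [] := AB i.
  by move=> [Ax Bx] i; split; [exact: Ax|exact: Bx].
- by apply/seteqP; split => // x _; exists 0%N.
- by move=> _ [A mA <-]; exact: m12.
Qed.

(** The law of a random variable is only known through its values on measurable
    sets; this is what turns such knowledge into a formula for integrals. *)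
Lemma ge0_integral_density d (T : measurableType d) (R : realType)
    (mu nu : {measure set T -> \bar R}) (w : T -> R) (f : T -> \bar R) :
  measurable_fun setT w -> (forall x, 0 <= w x) ->
  (forall A, measurable A -> nu A = \int[mu]_(x in A) (w x)%:E)%E ->
  measurable_fun setT f -> (forall x, 0 <= f x)%E ->
  (\int[nu]_x f x = \int[mu]_x (f x * (w x)%:E))%E.
Proof.
move=> mw w0 nuE mf f0.
have [nu' nu'E] := weighted_pushforward mu mw w0 (@measurable_id _ _ _).
rewrite -nu'E//; apply: eq_measure_integral => A mA _.
transitivity (\int[nu']_x (\1_A x)%:E)%E; last by rewrite integral_indic// setIT.
rewrite nu'E//; last by apply/measurable_EFinP; exact: measurable_indic.
rewrite nuE// integral_mkcond; apply: eq_integral => x _.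
by rewrite epatch_indic muleC.
Qed.

Lemma ge0_integral_law_density d (T : measurableType d) (R : realType)
    (P : probability T R) (X : T -> R) (w : R -> R) (f : R -> \bar R) :
  measurable_fun setT X -> measurable_fun setT w -> (forall x, 0 <= w x) ->
  (forall A : set R, measurable A ->
    P (X @^-1` A) = \int[@lebesgue_measure R]_(x in A) (w x)%:E)%E ->
  measurable_fun setT f -> (forall x, 0 <= f x)%E ->
  (\int[P]_t f (X t) = \int[@lebesgue_measure R]_x (f x * (w x)%:E))%E.
Proof.
move=> mX mw w0 law mf f0.
have [nu nuE] := @weighted_pushforward _ _ _ P (cst 1) (@measurable_cst _ _ _ _ _ _)
  (fun=> ler01) _ (measurableTypeR R) _ mX.
have -> : (\int[P]_t f (X t) = \int[nu]_x f x)%E.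
  by rewrite nuE//; apply: eq_integral => t _; rewrite mule1.
apply: ge0_integral_density => // A mA.
rewrite -(@integral_indicT _ (measurableTypeR R) _ nu)//.
rewrite nuE//; last by apply/measurable_EFinP; exact: measurable_indic.
under eq_integral do rewrite mule1.
have mAX : measurable (X @^-1` A).
  by rewrite -[X in measurable X]setTI; exact: mX.
transitivity (P (X @^-1` A)); last exact: law.
by rewrite -integral_indicT.
Qed.

(** * Dilations of normal laws *)

(** The quotient of the N(m, s^2) densities at c x and at x. *)
Definition normal_ratio (R : realType) (m s c x : R) : R :=
  expR (- ((c * x - m) ^+ 2 - (x - m) ^+ 2) / (s ^+ 2 *+ 2)).

Lemma measurable_normal_ratio (R : realType) (m s c : R) :
  measurable_fun setT (normal_ratio m s c).
Proof.
have mc : measurable_fun setT (fun x : R => c * x) by exact: measurable_funM.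
apply: (measurableT_comp (@measurable_expR R)); apply: measurable_funM => //.
apply: measurable_funN; apply: measurable_funB => //.
  by apply: measurable_funX; exact: measurable_funB.
by apply: measurable_funX; exact: measurable_funB.
Qed.

Lemma measurable_indic_scale (R : realType) (c : R) (A : set R) :
  measurable A -> measurable_fun setT (fun x : R => \1_A (c * x) : R).
Proof.
move=> mA; have mi : measurable_fun setT (\1_A : R -> R).
  exact: measurable_indic.
have mc : measurable_fun setT (fun x : R => c * x) by exact: measurable_funM.
exact: (measurableT_comp mi mc).
Qed.

Lemma normal_prob_scaling (R : realType) (m s c : R) (A : set R) :
  s != 0 -> c != 0 -> measurable A ->
  (\int[normal_prob m s]_x
     (\1_A (c * x) * normal_ratio m s c x)%:E =
   `|c|^-1%:E * normal_prob m s A)%E.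
Proof.
move=> s0 c0 mA.
have mc : measurable_fun setT (fun x : R => c * x) by exact: measurable_funM.
rewrite (@ge0_integral_density _ _ _ lebesgue_measure (normal_prob m s)
  (normal_pdf m s))//; last 4 first.
- exact: measurable_normal_pdf.
- exact: normal_pdf_ge0.
- apply/measurable_EFinP; apply: measurable_funM.
    exact: measurable_indic_scale.
  exact: measurable_normal_ratio.
- by move=> x; rewrite lee_fin mulr_ge0// expR_ge0.
have -> : normal_prob m s A =
    (\int[lebesgue_measure]_x ((\1_A x)%:E * (normal_pdf m s x)%:E))%E.
  rewrite /normal_prob integral_mkcond; apply: eq_integral => x _.
  by rewrite epatch_indic muleC.
rewrite (@ge0_integral_affine _ c 0
  (fun x => (\1_A x)%:E * (normal_pdf m s x)%:E)%E)//; last 2 first.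
- apply/measurable_EFinP; apply: measurable_funM => //.
  exact: measurable_normal_pdf.
- by move=> x; rewrite -EFinM lee_fin mulr_ge0// normal_pdf_ge0.
rewrite muleA -EFinM mulVf ?normr_eq0// mul1e.
apply: eq_integral => x _; rewrite addr0 -!EFinM -mulrA; congr (_ * _)%:E.
rewrite (normal_pdfE _ s0) mulrCA; congr (_ * _).
rewrite /normal_fun /normal_ratio -expRD; congr expR; rewrite -mulrDl; congr (_ / _).
ring.
Qed.

Section scaling.
Context d (T : measurableType d) (R : realType) (P : probability T R) (p : nat).
Variables (U : {RV P >-> p.-tuple R}) (xi : 'rV[R]_p) (s2 : R).
Hypotheses (s20 : 0 < s2) (lawU : isotropic_normal U xi s2).

Definition inner (R : realType) p (xi : 'rV[R]_p) (u : p.-tuple R) : R :=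
  \sum_(i < p) xi ord0 i * tnth u i.

Definition tscale (c : R) (u : p.-tuple R) : p.-tuple R :=
  [tuple c * tnth u i | i < p].

(** On a box this is a product of one-dimensional changes of variables, and boxes
    determine the law. The exponent is -(|c u - xi|^2 - |u - xi|^2)/(2 s2), where
    |xi|^2 cancels. *)
Lemma isotropic_normal_scaling (c : R) (F : p.-tuple R -> \bar R) :
  c != 0 -> measurable_fun setT F -> (forall u, 0 <= F u)%E ->
  (\int[P]_w F (U w) = (`|c| ^+ p)%:E * \int[P]_w (F (tscale c (U w)) *
    (expR (- ((c ^+ 2 - 1) * sqnorm (U w) - (c - 1) * inner xi (U w) *+ 2) /
           (s2 *+ 2)))%:E))%E.
Proof.
move=> c0 mF F0.
have mU i : measurable_fun setT (fun w => tnth (U w) i).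
  by apply: (measurableT_comp (measurable_tnth i)) => //.
have mcU : measurable_fun setT (fun w => tscale c (U w)).
  apply/measurable_fun_tnthP => i; rewrite /comp/=.
  under eq_fun do rewrite tnth_mktuple.
  exact: measurable_funM.
pose s := Num.sqrt s2.
have s0 : s != 0 by rewrite sqrtr_eq0 -ltNge.
have ss : s ^+ 2 = s2 by rewrite sqr_sqrtr// ltW.
pose h i := normal_ratio (xi ord0 i) s c.
have mh i : measurable_fun setT (h i) by exact: measurable_normal_ratio.
pose v w := `|c| ^+ p * \prod_i h i (tnth (U w) i).
have hE w : \prod_i h i (tnth (U w) i) =
  expR (- ((c ^+ 2 - 1) * sqnorm (U w) - (c - 1) * inner xi (U w) *+ 2) / (s2 *+ 2)).
  rewrite /h /normal_ratio -expR_sum; congr expR; rewrite -mulr_suml ss; congr (_ / _).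
  rewrite /sqnorm /dotp /inner mulr_sumr mulr_sumr -sumrMnl -sumrB -sumrN.
  by apply: eq_bigr => i _; ring.
have mv : measurable_fun setT v.
  apply: measurable_funM => //; apply: measurable_prod_fun => i.
  exact: measurableT_comp.
have v0 w : 0 <= v w.
  by rewrite mulr_ge0 ?exprn_ge0// prodr_ge0// => i _; exact: expR_ge0.
have [nu nuE] := weighted_pushforward P mv v0 mcU.
transitivity (\int[nu]_x F x)%E; last first.
  rewrite nuE// -ge0_integralZl//; last 2 first.
  - apply: emeasurable_funM; first exact: measurableT_comp.
    apply/measurable_EFinP; under eq_fun do rewrite -hE.
    by apply: measurable_prod_fun => i; exact: measurableT_comp.
  - by move=> w _; rewrite mule_ge0// lee_fin expR_ge0.
  apply: eq_integral => w _; rewrite /v hE.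
  by rewrite muleCA EFinM.
rewrite -ge0_integral_distribution//.
apply: eq_measure_integral => A mA _; apply: tuple_measure_unique => //.
  by apply: (@le_lt_trans _ _ 1%E); [exact: probability_le1|exact: ltry].
move=> {mA}A mA; transitivity (\prod_(i < p) normal_prob (xi ord0 i) s (A i))%E.
  exact: lawU.
transitivity (\int[nu]_x (\1_(box A) x)%:E)%E; last first.
  by rewrite integral_indicT//; exact: measurable_box.
rewrite nuE//; last first.
  by apply/measurable_EFinP; apply: measurable_indic; exact: measurable_box.
pose f i x := \1_(A i) (c * x) * h i x.
pose N (i : 'I_p) : probability (measurableTypeR R) R := normal_prob (xi ord0 i) s.
pose q i := fine (normal_prob (xi ord0 i) s (A i)).
have qE i : normal_prob (xi ord0 i) s (A i) = (q i)%:E.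
  by rewrite /q fineK//; apply: (fin_num_measure (normal_prob (xi ord0 i) s)); exact: mA.
have prodE : (\int[P]_w (\prod_i f i (tnth (U w) i))%:E = (\prod_i (`|c|^-1 * q i))%:E)%E.
  apply: (@ge0_integral_prod _ _ _ P p (fun i w => tnth (U w) i) N f) => //.
  - move=> i; apply: measurable_funM; last exact: (mh i).
    exact: measurable_indic_scale.
  - by move=> i x; rewrite mulr_ge0// expR_ge0.
  - by move=> i; rewrite normal_prob_scaling// qE.
have -> : (\prod_(i < p) normal_prob (xi ord0 i) s (A i) = (\prod_i q i)%:E)%E.
  by rewrite -prodEFin; apply: eq_bigr.
have -> : \prod_i q i = `|c| ^+ p * \prod_i (`|c|^-1 * q i).
  rewrite big_split/= prodr_const card_ord mulrA -exprMn divff ?normr_eq0//.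
  by rewrite expr1n mul1r.
rewrite EFinM -prodE -ge0_integralZl//; last 2 first.
- apply/measurable_EFinP; apply: measurable_prod_fun => i.
  apply: measurable_funM; last exact: measurableT_comp.
  exact: (measurableT_comp (measurable_indic_scale c (mA i)) (mU i)).
- by move=> w _; rewrite lee_fin prodr_ge0// => i _; rewrite mulr_ge0// expR_ge0.
apply: eq_integral => w _; rewrite -!EFinM /v mulrCA big_split/=; congr (_ * (_ * _))%:E.
have [wA|wA] := pselect (box A (tscale c (U w))).
  rewrite [RHS]indicE mem_set// big1// => i _.
  by have := wA i; rewrite tnth_mktuple indicE => ?; rewrite mem_set.
rewrite [RHS]indicE memNset//.
move/existsNP : wA => [i wA].
by rewrite (bigD1 i)//= indicE memNset ?mul0r//; rewrite tnth_mktuple in wA.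
Qed.
End scaling.

(** * Real-valued expectations and elementary estimates *)

Section real_integral.
Context d (T : measurableType d) (R : realType) (P : probability T R).
Implicit Types f g h : T -> R.

Lemma integrable_le f g : measurable_fun setT f -> (forall x, `|f x| <= g x) ->
  P.-integrable setT (EFin \o g) -> P.-integrable setT (EFin \o f).
Proof.
move=> mf fg ig; apply: (le_integrable measurableT _ _ ig).
  exact/measurable_EFinP.
move=> x _ /=; rewrite lee_fin (le_trans (fg x))//; exact: ler_norm.
Qed.

Lemma integrable_cst1 : P.-integrable setT (EFin \o cst (1 : R)).
Proof. by apply: (finite_measure_integrable_cst P 1). Qed.

Lemma Rintegral_EFin f : P.-integrable setT (EFin \o f) ->
  ((\int[P]_w f w)%:E = \int[P]_w (f w)%:E)%E.
Proof. by move=> fi; rewrite fineK//; exact: integrable_fin_num. Qed.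

Lemma ge0_integrable f : measurable_fun setT f -> (forall x, 0 <= f x) ->
  (\int[P]_w (f w)%:E < +oo)%E -> P.-integrable setT (EFin \o f).
Proof.
move=> mf f0 foo; apply/integrableP; split; first exact/measurable_EFinP.
by under eq_integral do rewrite /= ger0_norm//.
Qed.

(** Comparing the two parts only involves nonnegative integrands, which is the
    form that changes of variables provide. *)
Lemma Rintegral_ge0_parts f : P.-integrable setT (EFin \o f) ->
  (\int[P]_w (Num.max (- f w) 0)%:E <= \int[P]_w (Num.max (f w) 0)%:E)%E ->
  0 <= \int[P]_w f w.
Proof.
move=> fi fle; rewrite -lee_fin Rintegral_EFin// integralE.
have pE : (\int[P]_w (EFin \o f)^\+ w = \int[P]_w (Num.max (f w) 0)%:E)%E.
  by apply: eq_integral => w _; rewrite funeposE /= EFin_max.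
have nE : (\int[P]_w (EFin \o f)^\- w = \int[P]_w (Num.max (- f w) 0)%:E)%E.
  by apply: eq_integral => w _; rewrite funenegE /= EFin_max.
rewrite sube_ge0 ?pE ?nE//; apply/orP; left; rewrite -nE.
by apply: integrable_fin_num => //; exact: integrable_funeneg.
Qed.

Lemma integrable_add (f g : T -> R) : P.-integrable setT (EFin \o f) ->
  P.-integrable setT (EFin \o g) -> P.-integrable setT (EFin \o (fun w => f w + g w)).
Proof. by move=> fi gi; exact: (integrableD measurableT fi gi). Qed.

Lemma integrable_scale (c : R) (f : T -> R) : P.-integrable setT (EFin \o f) ->
  P.-integrable setT (EFin \o (fun w => c * f w)).
Proof. by move=> fi; exact: (integrableZl measurableT c fi). Qed.

Lemma Rintegral_sum (I : Type) (s : seq I) (f : I -> T -> R) :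
  (forall i, P.-integrable setT (EFin \o f i)) ->
  P.-integrable setT (EFin \o (fun w => \sum_(i <- s) f i w)) /\
  \int[P]_w (\sum_(i <- s) f i w) = \sum_(i <- s) \int[P]_w f i w.
Proof.
move=> fi; elim: s => [|i s [IHi IHe]].
  split.
    by under eq_fun do rewrite big_nil; exact: finite_measure_integrable_cst.
  under eq_Rintegral do rewrite big_nil.
  by rewrite big_nil Rintegral_cst// mul0r.
split; first by under eq_fun do rewrite big_cons; exact: integrable_add.
under eq_Rintegral do rewrite big_cons.
by rewrite big_cons RintegralD// IHe.
Qed.

End real_integral.

Lemma bernoulli_ge (R : realDomainType) (e : R) n :
  0 <= e -> 1 + n%:R * e <= (1 + e) ^+ n.
Proof.
move=> e0; elim: n => [|n IH]; first by rewrite mul0r addr0 expr0.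
rewrite exprS; apply: le_trans (ler_wpM2l _ IH); last by rewrite addr_ge0.
rewrite -subr_ge0 -natr1.
rewrite (_ : _ - _ = n%:R * e ^+ 2); last by ring.
by rewrite mulr_ge0// exprn_ge0.
Qed.

(** The first-order information carried by a dilation of ratio 1 + e: divide by e
    and let e tend to 0. *)
Lemma le_of_perturbed (R : realType) (A B C : R) n :
  (forall e, 0 < e -> A <= (1 + e) ^+ n * (B + e * C)) -> A <= B.
Proof.
move=> H; pose u k : R := (1 + harmonic k) ^+ n * (B + harmonic k * C).
have uB : u k @[k --> \oo] --> (1 + 0) ^+ n * (B + 0 * C).
  have h0 := @cvg_harmonic R.
  have h1 : (1 + harmonic k : R) @[k --> \oo] --> (1 + 0 : R).
    by apply: cvgD => //; exact: cvg_cst.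
  have h2 : (B + harmonic k * C : R) @[k --> \oo] --> (B + 0 * C : R).
    by apply: cvgD; [exact: cvg_cst|apply: cvgM => //; exact: cvg_cst].
  apply: cvgM h2.
  exact: (continuous_cvg _ (@exprn_continuous R n (1 + 0)) h1).
rewrite addr0 expr1n mul1r mul0r addr0 in uB.
rewrite -(cvg_lim (@Rhausdorff R) uB); apply: limr_ge; first by apply/cvg_ex; exists B.
by apply: nearW => k; apply: H; rewrite /harmonic/= invr_gt0.
Qed.

Lemma sqnorm_ge0 (R : realType) p (u : p.-tuple R) : 0 <= sqnorm u.
Proof. by apply: sumr_ge0 => i _; rewrite -expr2 sqr_ge0. Qed.

Lemma measurable_sqnorm (R : realType) p : measurable_fun setT (@sqnorm R p).
Proof.
apply: measurable_sum => i; apply: measurable_funM; exact: measurable_tnth.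
Qed.

Lemma measurable_inner (R : realType) p (xi : 'rV[R]_p) : measurable_fun setT (inner xi).
Proof.
by apply: measurable_sum => i; apply: measurable_funM => //; exact: measurable_tnth.
Qed.

Lemma sqnorm_scale (R : realType) p c (u : p.-tuple R) :
  sqnorm (tscale c u) = c ^+ 2 * sqnorm u.
Proof.
by rewrite /sqnorm /dotp mulr_sumr; apply: eq_bigr => i _; rewrite tnth_mktuple; ring.
Qed.

Lemma inner_scale (R : realType) p (xi : 'rV[R]_p) c (u : p.-tuple R) :
  inner xi (tscale c u) = c * inner xi u.
Proof.
by rewrite /inner mulr_sumr; apply: eq_bigr => i _; rewrite tnth_mktuple; ring.
Qed.

(** From |a b| <= a^2 + b^2 in each coordinate: moments of order one are
    dominated by those of order two, without square roots. *)
Lemma inner_bound (R : realType) p (xi : 'rV[R]_p) (u : p.-tuple R) :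
  `|inner xi u| <= \sum_i xi ord0 i ^+ 2 + sqnorm u.
Proof.
rewrite (le_trans (ler_norm_sum _ _ _))// /sqnorm /dotp -big_split/=.
apply: ler_sum => i _; rewrite normrM -expr2 -[leRHS]addr0.
set a := xi _ _; set b := tnth _ _.
rewrite -(real_normK (num_real a)) -(real_normK (num_real b)).
have := normr_ge0 a; have := normr_ge0 b; set x := `|a|; set y := `|b|; nra.
Qed.

(** For delta > 0 this function is bounded; for delta = 0 it is |u|^(-2k), with
    value 0 at the origin when k > 0. *)
Definition invpow (R : realType) p (delta : R) k (u : p.-tuple R) : R :=
  (sqnorm u + delta)^-1 ^+ k.

Lemma measurable_inv_ge0 d (T : measurableType d) (R : realType) (f : T -> R) :
  measurable_fun setT f -> (forall x, 0 <= f x) ->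
  measurable_fun setT (fun x => (f x)^-1).
Proof.
move=> mf f0; under eq_fun do rewrite -powR_inv1//.
exact: (measurableT_comp (measurable_powR _) mf).
Qed.

Lemma invpow_ge0 (R : realType) p (delta : R) k (u : p.-tuple R) :
  0 <= delta -> 0 <= invpow delta k u.
Proof. by move=> d0; rewrite exprn_ge0// invr_ge0 addr_ge0// sqnorm_ge0. Qed.

Lemma measurable_invpow (R : realType) p (delta : R) k :
  0 <= delta -> measurable_fun setT (@invpow R p delta k).
Proof.
move=> d0; apply: measurable_funX; apply: measurable_inv_ge0.
  by apply: measurable_funD => //; exact: measurable_sqnorm.
by move=> u; rewrite addr_ge0// sqnorm_ge0.
Qed.

(** * Reflection and the one-sided Stein inequality *)

Section stein.
Context d (T : measurableType d) (R : realType) (P : probability T R) (p : nat).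
Variables (U : {RV P >-> p.-tuple R}) (xi : 'rV[R]_p) (s2 : R).
Hypotheses (s20 : 0 < s2) (lawU : isotropic_normal U xi s2).

Let L w := inner xi (U w).
Let N w := sqnorm (U w).
Let q delta k w := invpow delta k (U w).

Let mL : measurable_fun setT L.
Proof. exact: (measurableT_comp (measurable_inner xi)). Qed.

Let mN : measurable_fun setT N.
Proof. exact: (measurableT_comp (@measurable_sqnorm R p)). Qed.

Let mq delta k : 0 <= delta -> measurable_fun setT (q delta k).
Proof. by move=> d0; exact: (measurableT_comp (@measurable_invpow R p delta k d0)). Qed.

Lemma measurable_normal_weight (c : R) : measurable_fun setT (fun w =>
  expR (- ((c ^+ 2 - 1) * N w - (c - 1) * L w *+ 2) / (s2 *+ 2))).
Proof.
apply: (measurableT_comp (@measurable_expR R)); apply: measurable_funM => //.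
apply: measurable_funN; apply: measurable_funB; first exact: measurable_funM.
by under eq_fun do rewrite -mulrnAl; exact: measurable_funM.
Qed.

(** The reflection carries the negative part of L to its positive part, with
    the weight exp(-2 L/s2), which is at most 1 where L >= 0. *)
Lemma normal_reflection_le (g : p.-tuple R -> R) :
  measurable_fun setT g -> (forall u, 0 <= g u) ->
  (forall u, g (tscale (-1) u) = g u) ->
  (\int[P]_w (g (U w) * Num.max (- L w) 0)%:E <=
   \int[P]_w (g (U w) * Num.max (L w) 0)%:E)%E.
Proof.
move=> mg g0 geven.
have c0 : (-1 : R) != 0 by rewrite oppr_eq0 oner_eq0.
have mmax (h : p.-tuple R -> R) : measurable_fun setT h ->
    measurable_fun setT (fun u => (g u * Num.max (h u) 0)%:E).
  move=> mh; apply/measurable_EFinP; apply: measurable_funM => //.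
  exact: measurable_maxr.
have mgL : measurable_fun setT (fun w => (g (U w) * Num.max (L w) 0)%:E).
  exact: (measurableT_comp (mmax _ (measurable_inner xi))).
rewrite (isotropic_normal_scaling s20 lawU c0
  (F := fun u => (g u * Num.max (- inner xi u) 0)%:E)); last 2 first.
- apply: mmax; apply: measurable_funN; exact: measurable_inner.
- by move=> u; rewrite lee_fin mulr_ge0// le_max lexx orbT.
rewrite normrN1 expr1n mul1e; apply: ge0_le_integral => //.
- by move=> w _; apply: mule_ge0; rewrite lee_fin ?expR_ge0// mulr_ge0// le_max lexx orbT.
- apply: emeasurable_funM; last first.
    by apply/measurable_EFinP; exact: measurable_normal_weight.
  apply/measurable_EFinP; apply: measurable_funM.
    under eq_fun do rewrite geven; exact: (measurableT_comp mg).
  under eq_fun do rewrite inner_scale mulN1r opprK.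
  exact: measurable_maxr.
move=> w _; rewrite geven inner_scale mulN1r opprK -EFinM lee_fin -/(L w).
have [L0|L0] := leP (L w) 0.
  by rewrite mulr0 mul0r.
rewrite ler_piMr ?mulr_ge0// ?(ltW L0)// -[leRHS]expR0 ler_expR.
rewrite mulNr oppr_le0 divr_ge0//; last by rewrite mulrn_wge0// ltW.
rewrite [leRHS](_ : _ = L w * 4); last by rewrite /L; ring.
by rewrite mulr_ge0// ltW.
Qed.

Lemma even_inner_ge0 (g : p.-tuple R -> R) :
  measurable_fun setT g -> (forall u, 0 <= g u) ->
  (forall u, g (tscale (-1) u) = g u) ->
  P.-integrable setT (EFin \o (fun w => g (U w) * L w)) ->
  0 <= \int[P]_w (g (U w) * L w).
Proof.
move=> mg g0 ge gi; apply: Rintegral_ge0_parts => //.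
have := normal_reflection_le mg g0 ge; congr (_ <= _)%E; apply: eq_integral => w _.
  by rewrite -mulrN -{2}(mulr0 (g (U w))) maxr_pMr.
by rewrite -{2}(mulr0 (g (U w))) maxr_pMr.
Qed.

Lemma invpow_even delta k (u : p.-tuple R) :
  invpow delta k (tscale (-1) u) = invpow delta k u.
Proof. by rewrite /invpow sqnorm_scale sqrrN expr1n mul1r. Qed.

Let q0 delta k w : 0 <= delta -> 0 <= q delta k w.
Proof. exact: invpow_ge0. Qed.

Let qS delta k w : q delta k.+1 w = (N w + delta)^-1 * q delta k w.
Proof. by rewrite /q /invpow exprS. Qed.

Lemma invpow_N_le delta k w : 0 <= delta ->
  0 <= q delta k.+1 w * N w <= q delta k w.
Proof.
move=> d0; have N0 : 0 <= N w := sqnorm_ge0 _.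
rewrite mulr_ge0//= ?q0// qS mulrAC ler_piMl ?q0//.
have [->|Nd] := eqVneq (N w + delta) 0; first by rewrite invr0 mul0r.
have Nd0 : 0 < N w + delta by rewrite lt_neqAle eq_sym Nd addr_ge0.
by rewrite mulrC ler_pdivrMr// mul1r lerDl.
Qed.

Lemma invpow_le_succ delta k w : 0 <= delta ->
  q delta k w <= 1 + q delta k.+1 w.
Proof.
move=> d0; rewrite qS; set x := (N w + delta)^-1.
have x0 : 0 <= x by rewrite invr_ge0 addr_ge0// sqnorm_ge0.
have [x1|x1] := leP x 1.
  rewrite -[leLHS]addr0 lerD// ?mulr_ge0 ?q0//; exact: exprn_ile1.
by rewrite -[leLHS]add0r lerD// ler_peMl ?q0// ltW.
Qed.

Lemma invpow_integrable_pred delta k : 0 <= delta ->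
  P.-integrable setT (EFin \o q delta k.+1) ->
  P.-integrable setT (EFin \o q delta k).
Proof.
move=> d0 qi; apply: (integrable_le (g := fun w => 1 + q delta k.+1 w)).
- exact: mq.
- by move=> w; rewrite ger0_norm ?q0//; exact: invpow_le_succ.
- exact: (integrable_add (integrable_cst1 P) qi).
Qed.

Lemma invpow_N_integrable delta k : 0 <= delta ->
  P.-integrable setT (EFin \o q delta k.+1) ->
  P.-integrable setT (EFin \o (fun w => q delta k.+1 w * N w)).
Proof.
move=> d0 /(invpow_integrable_pred d0); apply: integrable_le.
  by apply: measurable_funM => //; exact: mq.
by move=> w; have /andP[? ?] := invpow_N_le k w d0; rewrite ger0_norm.
Qed.

Lemma invpow_dominated_integrable delta k (h : T -> R) (C : R) : 0 <= delta ->
  measurable_fun setT h -> (forall w, `|h w| <= C + N w) ->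
  P.-integrable setT (EFin \o q delta k.+1) ->
  P.-integrable setT (EFin \o (fun w => q delta k.+1 w * h w)).
Proof.
move=> d0 mh hC qi.
apply: (integrable_le (g := fun w => C * q delta k.+1 w + q delta k.+1 w * N w)).
- by apply: measurable_funM => //; exact: mq.
- move=> w; rewrite normrM ger0_norm ?q0// [C * _]mulrC -mulrDr.
  by rewrite ler_wpM2l ?q0.
exact: (integrable_add (integrable_scale C qi) (invpow_N_integrable d0 qi)).
Qed.

Let L_bound w : `|L w| <= \sum_i xi ord0 i ^+ 2 + N w.
Proof. exact: inner_bound. Qed.

(** Dilation by c = 1 + e applied to (N + delta)^-(k+1). The function loses at
    most a factor c^(2k+2), the Jacobian gains c^p, and exp x >= 1 + x bounds the
    likelihood ratio from below; the powers of c combine into c^(p-2k-2), which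
    Bernoulli's inequality bounds from below by 1 + (p-2k-2) e. *)
Lemma stein_perturbed delta k e : 0 <= delta -> (k.+1.*2 <= p)%N -> 0 < e ->
  P.-integrable setT (EFin \o q delta k.+1) ->
  (p - k.+1.*2)%:R * \int[P]_w q delta k.+1 w <=
  (1 + e) ^+ (p - k.+1.*2) *
    ((\int[P]_w (q delta k.+1 w * N w) - \int[P]_w (q delta k.+1 w * L w)) / s2 +
     e * (\int[P]_w (q delta k.+1 w * N w) / (s2 *+ 2))).
Proof.
move=> d0 kp e0 qi; set n := (p - k.+1.*2)%N; set M := \int[P]_w q _ _ w.
set A := \int[P]_w (_ * N w); set B := \int[P]_w (_ * L w).
have qNi := invpow_N_integrable d0 qi.
have qLi := invpow_dominated_integrable d0 mL L_bound qi.
pose c := 1 + e.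
have c0 : 0 < c by rewrite addr_gt0.
have cn0 : c != 0 by rewrite gt_eqF.
pose W w := expR (- ((c ^+ 2 - 1) * N w - (c - 1) * L w *+ 2) / (s2 *+ 2)).
pose G w := invpow delta k.+1 (tscale c (U w)) * W w.
have G0 w : 0 <= G w by rewrite mulr_ge0 ?invpow_ge0 ?expR_ge0.
have mG : measurable_fun setT G.
  apply: measurable_funM; last exact: measurable_normal_weight.
  apply: measurable_funX; apply: measurable_inv_ge0.
    apply: measurable_funD => //; under eq_fun do rewrite sqnorm_scale.
    exact: measurable_funM.
  by move=> w; rewrite addr_ge0// sqnorm_ge0.
have ME : (M%:E = (c ^+ p)%:E * \int[P]_w (G w)%:E)%E.
  rewrite Rintegral_EFin//.
  rewrite (isotropic_normal_scaling s20 lawU cn0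
    (F := fun u => (invpow delta k.+1 u)%:E)); last 2 first.
  - by apply/measurable_EFinP; exact: measurable_invpow.
  - by move=> u; rewrite lee_fin invpow_ge0.
  by rewrite gtr0_norm.
have cp0 : 0 < c ^+ p by rewrite exprn_gt0.
have Gi : P.-integrable setT (EFin \o G).
  apply: ge0_integrable => //.
  have -> : (\int[P]_w (G w)%:E = ((c ^+ p)^-1 * M)%:E)%E.
    by rewrite EFinM ME muleA -EFinM mulVf ?gt_eqF// mul1e.
  by rewrite ltry.
have {}ME : M = c ^+ p * \int[P]_w G w.
  by apply: EFin_inj; rewrite ME EFinM (Rintegral_EFin Gi).
pose D w := q delta k.+1 w - (e / (s2 *+ 2)) *
  ((2 + e) * (q delta k.+1 w * N w) - 2 * (q delta k.+1 w * L w)).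
have DG w : D w <= c ^+ k.+1.*2 * G w.
  have N0 : 0 <= N w := sqnorm_ge0 _.
  have qc : q delta k.+1 w <= c ^+ k.+1.*2 * invpow delta k.+1 (tscale c (U w)).
    rewrite /q /invpow -mul2n exprM -exprMn sqnorm_scale -/(N w).
    have c20 : 0 <= c ^+ 2 by rewrite sqr_ge0.
    have cNd0 : 0 <= c ^+ 2 * N w + delta := addr_ge0 (mulr_ge0 c20 N0) d0.
    have [Nd|Nd] := eqVneq (N w + delta) 0.
      by rewrite Nd invr0 expr0n/=; apply: exprn_ge0; rewrite mulr_ge0 ?invr_ge0.
    have Nd0 : 0 < N w + delta by rewrite lt_neqAle eq_sym Nd addr_ge0.
    have c1 : 1 <= c ^+ 2 by rewrite exprn_ege1// lerDl ltW.
    have Ncd : 0 < c ^+ 2 * N w + delta.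
      by rewrite (lt_le_trans Nd0)// lerD2r ler_peMl.
    apply: lerXn2r; first by rewrite nnegrE invr_ge0 ltW.
      by rewrite nnegrE; apply: mulr_ge0; rewrite ?invr_ge0.
    by rewrite ler_pdivlMr// mulrC ler_pdivrMr// mulrDr lerD2l ler_peMl.
  have W0 : 0 <= W w := expR_ge0 _.
  have WD : 1 - (e / (s2 *+ 2)) * ((2 + e) * N w - 2 * L w) <= W w.
    apply: le_trans (expR_ge1Dx _).
    rewrite le_eqVlt; apply/orP; left; apply/eqP; rewrite /c; field.
    by rewrite gt_eqF.
  rewrite mulrA; apply: le_trans (ler_wpM2r W0 qc).
  apply: le_trans (ler_wpM2l (q0 _ _ d0) WD).
  by rewrite le_eqVlt; apply/orP; left; apply/eqP; rewrite /D; ring.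
have qNZ := integrableZl measurableT (2 + e) qNi.
have qLZ := integrableZl measurableT 2 qLi.
have qNLi : P.-integrable setT (EFin \o (fun w =>
    (2 + e) * (q delta k.+1 w * N w) - 2 * (q delta k.+1 w * L w))).
  exact: (integrableB measurableT qNZ qLZ).
have qNLZ := integrableZl measurableT (e / (s2 *+ 2)) qNLi.
have Di : P.-integrable setT (EFin \o D) by exact: (integrableB measurableT qi qNLZ).
have DE : \int[P]_w D w = M - (e / (s2 *+ 2)) * ((2 + e) * A - 2 * B).
  rewrite RintegralB// RintegralZl// RintegralB//.
  by rewrite !RintegralZl.
have cGi := integrableZl measurableT (c ^+ k.+1.*2) Gi.
have DGi := le_Rintegral measurableT Di cGi (fun w _ => DG w).
rewrite DE RintegralZl// in DGi.
have cn : 0 < c ^+ n by rewrite exprn_gt0.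
have MD : c ^+ n * (M - e / (s2 *+ 2) * ((2 + e) * A - 2 * B)) <= M.
  have cpE : c ^+ p = c ^+ n * c ^+ k.+1.*2 by rewrite -exprD subnK.
  by rewrite [leRHS]ME cpE -[leRHS]mulrA ler_pM2l.
have M0 : 0 <= M by apply: Rintegral_ge0 => w _; exact: q0.
have be : (1 + n%:R * e) * M <= c ^+ n * M.
  by apply: ler_wpM2r => //; apply: bernoulli_ge; exact: ltW.
rewrite -(ler_pM2r e0); set X := c ^+ n in cn MD be *.
rewrite [leRHS](_ : _ = X * (e / (s2 *+ 2) * ((2 + e) * A - 2 * B))); last first.
  by rewrite -/c -/X; field; rewrite gt_eqF.
lra.
Qed.

(** In the limit e -> 0 the mean of N (N + delta)^-(k+1) appears, and this
    function is at most (N + delta)^-k. *)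
Lemma stein_le delta k : 0 <= delta -> (k.+1.*2 <= p)%N ->
  P.-integrable setT (EFin \o q delta k.+1) ->
  (p - k.+1.*2)%:R * s2 * \int[P]_w q delta k.+1 w <=
  \int[P]_w q delta k w - \int[P]_w (q delta k.+1 w * L w).
Proof.
move=> d0 kp qi; set B := \int[P]_w (_ * L w).
have qNi := invpow_N_integrable d0 qi.
have := le_of_perturbed (fun e e0 => stein_perturbed d0 kp e0 qi).
rewrite ler_pdivlMr// mulrAC => H; apply: le_trans H _; rewrite lerD2r.
apply: le_Rintegral => //; first exact: invpow_integrable_pred.
by move=> w _; have /andP[] := invpow_N_le k w d0.
Qed.

Lemma inner_invpow_ge0 delta k : 0 <= delta ->
  P.-integrable setT (EFin \o q delta k.+1) ->
  0 <= \int[P]_w (q delta k.+1 w * L w).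
Proof.
move=> d0 qi; apply: (even_inner_ge0 (g := invpow delta k.+1)).
- exact: measurable_invpow.
- by move=> u; exact: invpow_ge0.
- exact: invpow_even.
- exact: (invpow_dominated_integrable d0 mL L_bound qi).
Qed.

Lemma invpow_shifted_integrable delta k : 0 < delta ->
  P.-integrable setT (EFin \o q delta k).
Proof.
move=> d0; apply: (integrable_le (g := fun=> (delta^-1) ^+ k)).
- exact/mq/ltW.
- move=> w; rewrite ger0_norm ?q0 ?(ltW d0)// /q /invpow.
  apply: lerXn2r; rewrite ?nnegrE ?invr_ge0 ?addr_ge0 ?(ltW d0) ?sqnorm_ge0//.
  rewrite lef_pV2 ?posrE ?ltr_wpDl ?sqnorm_ge0//.
  by rewrite lerDr sqnorm_ge0.
- exact: finite_measure_integrable_cst.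
Qed.

(** Stein's inequality without its inner product term, nonnegative by
    reflection, bounds the mean of order k+1 by that of order k divided by
    (p - 2k - 2) s2; no constant depends on delta. *)
Lemma invpow_shifted_bounded k : (k.*2 < p)%N ->
  exists M : R, forall delta, 0 < delta -> \int[P]_w q delta k w <= M.
Proof.
elim: k => [|k IH] kp.
  exists 1 => delta d0; have -> : \int[P]_w q delta 0 w = \int[P]_w (cst 1 w).
    by apply: eq_Rintegral => w _; rewrite /q /invpow expr0.
  by rewrite Rintegral_cst//= mul1r probability_setT.
have [|M HM] := IH; first by apply: ltn_trans kp; rewrite ltn_double.
exists (M / ((p - k.+1.*2)%:R * s2)) => delta d0.
have s0 : 0 < (p - k.+1.*2)%:R * s2 by rewrite mulr_gt0// ltr0n subn_gt0.
rewrite ler_pdivlMr// mulrC.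
apply: le_trans (HM delta d0); have qi := invpow_shifted_integrable k.+1 d0.
apply: le_trans (stein_le (ltW d0) (ltnW kp) qi) _.
by rewrite gerBl; apply: inner_invpow_ge0 => //; exact: ltW.
Qed.

(** Monotone convergence along delta = 1/(n+1), away from the origin, where the
    limit function vanishes by convention. *)
Lemma invpow_integrable k : (k.*2 < p)%N -> P.-integrable setT (EFin \o q 0 k).
Proof.
case: k => [|k] kp.
  apply: (integrable_le (g := cst 1)); [exact: mq| |exact: integrable_cst1].
  by move=> w; rewrite /q /invpow expr0 normr1.
apply: ge0_integrable; [exact: mq|by move=> w; exact: q0|].
have [M HM] := invpow_shifted_bounded kp.
pose g n w : R := q (harmonic n) k.+1 w * (N w != 0)%:R.
have h0 n : 0 < harmonic n :> R by rewrite invr_gt0.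
have g0 n w : 0 <= g n w by rewrite mulr_ge0// q0// (ltW (h0 n)).
have mNn0 : measurable_fun setT (fun w => (N w != 0)%:R : R).
  rewrite (_ : (fun w => _) = \1_(N @^-1` [set~ 0])).
    apply: measurable_indic; rewrite -[X in measurable X]setTI; apply: mN => //.
    by apply: measurableC; exact: measurable_set1.
  apply/funext => w; rewrite indicE; congr (nat_of_bool _)%:R.
  apply/idP/idP => [/eqP NN|]; first by rewrite inE.
  by rewrite inE => /eqP.
have mg n : measurable_fun setT (g n).
  by apply: measurable_funM => //; apply: mq; exact: ltW.
have gM n : (\int[P]_w (g n w)%:E <= M%:E)%E.
  apply: (@le_trans _ _ (\int[P]_w (q (harmonic n) k.+1 w)%:E)%E).
    apply: ge0_le_integral => //.
    - by move=> w _; rewrite lee_fin.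
    - exact/measurable_EFinP.
    - by apply/measurable_EFinP; apply: mq; exact: ltW.
    - by move=> w _; rewrite lee_fin ler_piMr ?q0 ?(ltW (h0 n))// lern1 leq_b1.
  rewrite -Rintegral_EFin; last exact: invpow_shifted_integrable.
  by rewrite lee_fin; exact: HM.
have gq w : (g n w)%:E @[n --> \oo] --> (q 0 k.+1 w)%:E.
  apply: cvg_EFin; first exact: nearW.
  rewrite /g; have [Nw|Nw] := eqVneq (N w) 0.
    under eq_fun do rewrite mulr0.
    rewrite /q /invpow -/(N w) Nw addr0 invr0 expr0n; exact: cvg_cst.
  under eq_fun do rewrite mulr1.
  have N0 : N w + 0 != 0 by rewrite addr0.
  have h1 : (N w + harmonic n : R) @[n --> \oo] --> (N w + 0 : R).
    by apply: cvgD; [exact: cvg_cst|exact: cvg_harmonic].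
  exact: (continuous_cvg _ (@exprn_continuous R k.+1 _) (cvgV N0 h1)).
have gnd w : {homo (fun n => (g n w)%:E) : n m / (n <= m)%N >-> (n <= m)%E}.
  move=> n m nm; rewrite lee_fin ler_wpM2r// /q /invpow.
  have N0 : 0 <= N w := sqnorm_ge0 _.
  apply: lerXn2r; rewrite ?nnegrE ?invr_ge0 ?addr_ge0 ?(ltW (h0 _))//.
  rewrite lef_pV2 ?posrE ?ltr_wpDl// lerD2l /harmonic/=.
  by rewrite lef_pV2 ?posrE// ler_nat.
have -> : (\int[P]_w (q 0 k.+1 w)%:E = limn (fun n => \int[P]_w (g n w)%:E))%E.
  rewrite -monotone_convergence//.
  - by apply: eq_integral => w _; apply/esym/cvg_lim => //; exact: gq.
  - by move=> n; exact/measurable_EFinP.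
  - by move=> n w _; rewrite lee_fin.
apply: (@le_lt_trans _ _ M%:E); last exact: ltry.
apply: lime_le; last exact: nearW.
apply: ereal_nondecreasing_is_cvgn => n m nm; apply: ge0_le_integral => //.
- by move=> w _; rewrite lee_fin.
- exact/measurable_EFinP.
- exact/measurable_EFinP.
- by move=> w _; exact: gnd.
Qed.

End stein.

(** * The telescoping sum *)

Lemma coef_a0 (R : realType) p : coef_a R p 0 = 1.
Proof. by rewrite /coef_a big_nat big1// => i /andP[i1 i2]; case: i i1 i2. Qed.

Lemma coef_aS (R : realType) p j : (j.+1.*2 <= p)%N ->
  coef_a R p j.+1 = coef_a R p j * (p - j.+1.*2)%:R.
Proof. by move=> jp; rewrite /coef_a big_nat_recr//= mul2n natrB. Qed.

Lemma coef_a_ge0 (R : realType) p j : (j.*2 <= p)%N -> 0 <= coef_a R p j.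
Proof.
elim: j => [|j IH] jp; first by rewrite coef_a0.
by rewrite coef_aS// mulr_ge0// IH// (leq_trans _ jp)// leq_double.
Qed.

Lemma coef_b_gt0 (R : realType) m j : (0 < m)%N -> 0 < coef_b R m j.
Proof. by move=> m0; apply: prodr_gt0 => i _; rewrite ltr0n addn_gt0 m0. Qed.

Lemma coef_bS (R : realType) m j : coef_b R m j.+1 = coef_b R m j * (m + 2 * j)%:R.
Proof. by rewrite /coef_b big_nat_recr. Qed.

Section telescope.
Context d (T : measurableType d) (R : realType) (P : probability T R) (p : nat).
Variables (U : {RV P >-> p.-tuple R}) (xi : 'rV[R]_p) (s2 : R).
Hypotheses (s20 : 0 < s2) (lawU : isotropic_normal U xi s2).

(** The coefficients are chosen so that a_(n+1) s2^(n+1) g_(n+1) is what Stein's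
    inequality subtracts at step n, and what step n+1 adds back. *)
Lemma stein_telescope n : (n.*2 < p)%N ->
  \sum_(0 <= j < n) coef_a R p j * s2 ^+ j *
    \int[P]_w (invpow 0 j.+1 (U w) * inner xi (U w)) <=
  1 - coef_a R p n * s2 ^+ n * \int[P]_w invpow 0 n (U w).
Proof.
elim: n => [|n IH] np.
  rewrite big_geq// coef_a0 expr0 !mul1r.
  have -> : \int[P]_w invpow 0 0 (U w) = \int[P]_w (cst 1 w).
    by apply: eq_Rintegral => w _; rewrite /invpow expr0.
  by rewrite Rintegral_cst//= mul1r probability_setT/= subrr.
rewrite big_nat_recr//=.
have np' : (n.*2 < p)%N by apply: ltn_trans np; rewrite ltn_double.
apply: le_trans (lerD (IH np') (lexx _)) _.
have qi := invpow_integrable s20 lawU np.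
have st := stein_le s20 lawU (lexx 0) (ltnW np) qi.
have an0 : 0 <= coef_a R p n * s2 ^+ n.
  by rewrite mulr_ge0 ?exprn_ge0 ?coef_a_ge0 ?(ltW s20)// ltnW.
have := ler_wpM2l an0 st.
rewrite coef_aS ?(ltnW np)// exprS.
set X := \int[P]_w _; set Y := \int[P]_w _; set Z := \int[P]_w _; nra.
Qed.

Lemma stein_sum_le l : (l.+1.*2 < p)%N ->
  \int[P]_w (invpow 0 1 (U w) * inner xi (U w)) +
  \sum_(1 <= j < l.+1) coef_a R p j * s2 ^+ j *
    \int[P]_w (invpow 0 j.+1 (U w) * inner xi (U w)) <= 1.
Proof.
move=> lp; have := stein_telescope lp; rewrite big_ltn// coef_a0 expr0 !mul1r.
move=> H; apply: le_trans H _; rewrite gerBl mulr_ge0//.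
  by rewrite mulr_ge0 ?exprn_ge0 ?coef_a_ge0 ?(ltW s20)// ltnW.
by apply: Rintegral_ge0 => w _; exact: invpow_ge0.
Qed.
End telescope.

(** * Moments of chi-square laws *)

Section chi2.
Context (R : realType) (m : nat).

Let dens : R -> R := (chi2_pdf m) \_ `]0, +oo[.

Let chi2_pdf_ge0 x : 0 <= chi2_pdf m x :> R.
Proof.
rewrite /chi2_pdf divr_ge0// mulr_ge0 ?powR_ge0 ?expR_ge0//.
by apply: Rintegral_ge0 => y _; rewrite mulr_ge0 ?powR_ge0 ?expR_ge0.
Qed.

Let dens_ge0 x : 0 <= dens x.
Proof. by rewrite /dens patchE; case: ifP. Qed.

Let measurable_dens : measurable_fun setT dens.
Proof.
have mi : measurable (`]0, +oo[%classic : set R) by exact: measurable_itv.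
apply/(measurable_restrictT _ mi)/measurable_funTS.
apply: measurable_funM => //; apply: measurable_funM; first exact: measurable_powR.
apply: (measurableT_comp (@measurable_expR R)); apply: measurable_funM => //.
Qed.

Let dens_scale k x : 0 < k ->
  dens (k * x) = k `^ (m%:R / 2 - 1) * (dens x * expR ((1 - k) * x / 2)).
Proof.
move=> k0; rewrite /dens !patchE.
have -> : (k * x \in `]0, +oo[%classic) = (x \in `]0, +oo[%classic).
  by rewrite !mem_setE !in_itv/= !andbT pmulr_rgt0.
case: ifPn; last by rewrite mul0r mulr0.
rewrite mem_setE in_itv/= andbT => x0.
rewrite /chi2_pdf powRM ?ltW//.
have -> : expR (- (k * x) / 2) = expR (- x / 2) * expR ((1 - k) * x / 2).
  by rewrite -expRD; congr expR; field.
set K := (_ `^ _ * Gamma _)^-1; ring.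
Qed.

Context d (T : measurableType d) (P : probability T R) (S : {RV P >-> R}) (c : R).
Hypotheses (lawS : scaled_chi2 S c m).

Lemma ge0_integral_scaled_chi2 (f : R -> \bar R) :
  measurable_fun setT f -> (forall x, 0 <= f x)%E ->
  (\int[P]_w f (S w / c)%R = \int[@lebesgue_measure R]_x (f x * (dens x)%:E))%E.
Proof.
move=> mf f0; apply: ge0_integral_law_density => //; first exact: measurable_funM.
move=> A mA; rewrite lawS// /chi2_prob integral_mkcondr; apply: eq_integral => x _.
by rewrite /dens !patchE; case: ifP.
Qed.

(** The square makes every exponent an integer: the dilation x -> rho^-2 x
    multiplies x^(m/2-1) exp(-x/2) dx by rho^-m exp((1 - rho^-2) x/2), whatever
    the parity of m. *)
Lemma scaled_chi2_scaling (rho : R) (f : R -> \bar R) : 0 < rho ->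
  measurable_fun setT f -> (forall x, 0 <= f x)%E ->
  ((rho ^+ m)%:E * \int[P]_w f (S w / c)%R =
   \int[P]_w (f (rho ^- 2 * (S w / c))%R *
     (expR ((1 - rho ^- 2) * (S w / c) / 2))%:E))%E.
Proof.
move=> rho0 mf f0; set k := rho ^- 2.
have k0 : 0 < k by rewrite invr_gt0 exprn_gt0.
have mk : measurable_fun setT (fun x : R => k * x) by exact: measurable_funM.
have mE : measurable_fun setT (fun x : R => (expR ((1 - k) * x / 2))%:E).
  apply/measurable_EFinP; apply: (measurableT_comp (@measurable_expR R)).
  by apply: measurable_funM => //; exact: measurable_funM.
have mfk : measurable_fun setT (fun x : R => f (k * x)) by exact: (measurableT_comp mf).
have fk0 x : (0 <= f (k * x)%R * (expR ((1 - k) * x / 2))%:E)%E.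
  by rewrite mule_ge0// lee_fin expR_ge0.
rewrite (@ge0_integral_scaled_chi2
  (fun x => f (k * x)%R * (expR ((1 - k) * x / 2))%:E)%E)//; last first.
  exact: emeasurable_funM.
rewrite ge0_integral_scaled_chi2//.
have mdE : measurable_fun setT (fun x => (dens x)%:E) by exact/measurable_EFinP.
have mF : measurable_fun setT (fun x : R =>
    f (k * x)%R * (expR ((1 - k) * x / 2))%:E * (dens x)%:E)%E.
  by apply: emeasurable_funM => //; exact: emeasurable_funM.
rewrite (@ge0_integral_affine _ k 0
  (fun x => f x * (dens x)%:E)%E) ?gt_eqF//; last 2 first.
- exact: emeasurable_funM.
- by move=> x; rewrite mule_ge0// lee_fin.
have kE : k = (rho^-1) ^+ 2 by rewrite exprVn.
have km : k * k `^ (m%:R / 2 - 1) = rho ^- m.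
  have -> : k * k `^ (m%:R / 2 - 1) = k `^ (m%:R / 2).
    rewrite -{1}(powRr1 (ltW k0)) -powRD; last by rewrite (gt_eqF k0) implybT.
    by congr powR; ring.
  have -> : k = rho^-1 `^ 2%:R by rewrite kE powR_mulrn// invr_ge0 ltW.
  rewrite -powRrM (_ : 2%:R * (m%:R / 2) = m%:R); last by field.
  by rewrite powR_mulrn ?invr_ge0 ?(ltW rho0)// exprVn.
rewrite gtr0_norm// muleA -EFinM.
rewrite (eq_integral (fun x : measurableTypeR R => (k `^ (m%:R / 2 - 1))%:E *
    (f (k * x)%R * (expR ((1 - k) * x / 2))%:E * (dens x)%:E))%E); last first.
  move=> x _; rewrite addr0 dens_scale// EFinM muleCA -muleA -EFinM.
  by rewrite [expR _ * _]mulrC.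
rewrite ge0_integralZl//; last 2 first.
- by move=> x _; rewrite mule_ge0// lee_fin.
- by rewrite lee_fin powR_ge0.
rewrite muleA -EFinM -mulrA km divff ?mul1e// expf_neq0// gt_eqF//.
Qed.

Hypotheses (c0 : 0 < c) (S0 : forall w, 0 < S w).

Lemma bernoulli_le (e : R) n : 0 <= e ->
  (1 + e) ^+ n - 1 <= n%:R * e * (1 + e) ^+ n.
Proof.
move=> e0; elim: n => [|n IH]; first by rewrite expr0 subrr !mul0r.
have r1 : 1 <= (1 + e) ^+ n.+1 by rewrite exprn_ege1// lerDl.
move: r1; rewrite exprS -natr1; set x := (1 + e) ^+ n in IH *; move=> r1.
have := ler_wpM2l (addr_ge0 ler01 e0) IH.
have := ler_wpM2l e0 r1.
set y := n%:R; nra.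
Qed.

(** With W = S/c and exp x >= 1 + x, the dilation of ratio (1+e)^-2 bounds
    e/(1+e)^2 E[W^(j+1)] by ((1+e)^(m+2j) - 1) E[W^j]. This gives finiteness and,
    as e -> 0, the recursion with factor m + 2j. The normalising constant of the
    density enters only through the total mass 1. *)
Lemma scaled_chi2_moment j :
  P.-integrable setT (EFin \o (fun w => (S w / c) ^+ j)) /\
  \int[P]_w (S w / c) ^+ j <= coef_b R m j.
Proof.
have mW n : measurable_fun setT (fun w => (S w / c) ^+ n).
  by apply: measurable_funX; exact: measurable_funM.
have W0 w : 0 < S w / c by exact: divr_gt0.
elim: j => [|j [ji jle]].
  split.
    by under eq_fun do rewrite expr0; exact: integrable_cst1.
  under eq_Rintegral do rewrite expr0.
  by rewrite Rintegral_cst//= mul1r probability_setT/= /coef_b big_geq.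
pose M n := (\int[P]_w ((S w / c) ^+ n)%:E)%E.
have M0 n : (0 <= M n)%E.
  by apply: integral_ge0 => w _; rewrite lee_fin exprn_ge0// ltW.
(* The coefficient e/(1+e)^2 is a lower bound of (1 - (1+e)^-2)/2. *)
have step e : 0 < e -> (M j + (e / (1 + e) ^+ 2)%:E * M j.+1 <=
    ((1 + e) ^+ (m + 2 * j))%:E * M j)%E.
  move=> e0; set rho := 1 + e; have rho0 : 0 < rho by rewrite addr_gt0.
  have mf : measurable_fun setT (fun x : R => (`|x| ^+ j)%:E).
    apply/measurable_EFinP; apply: measurable_funX; exact: normr_measurable.
  have sc := scaled_chi2_scaling rho0 mf.
  have mWE n : measurable_fun setT (fun w =>
      ((S w / c) ^+ n * expR ((1 - rho ^- 2) * (S w / c) / 2))%:E).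
    apply/measurable_EFinP; apply: measurable_funM => //.
    apply: (measurableT_comp (@measurable_expR R)); apply: measurable_funM => //.
    by apply: measurable_funM => //; exact: measurable_funM.
  have kE : (rho ^- 2 : R) = (rho^-1) ^+ 2 by rewrite exprVn.
  have k0 : 0 < rho ^- 2 by rewrite invr_gt0 exprn_gt0.
  have -> : (((1 + e) ^+ (m + 2 * j))%:E * M j =
      \int[P]_w ((S w / c) ^+ j * expR ((1 - rho ^- 2) * (S w / c) / 2))%:E)%E.
    have -> : M j = (\int[P]_w (`|S w / c| ^+ j)%:E)%E.
      by apply: eq_integral => w _; rewrite gtr0_norm.
    rewrite exprD EFinM -/rho [((rho ^+ m)%:E * _)%E]muleC -muleA sc; last first.
      by move=> x; rewrite lee_fin exprn_ge0.
    have nE w : ((`|rho ^- 2 * (S w / c)| ^+ j)%:E =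
        ((rho ^- 2) ^+ j)%:E * ((S w / c) ^+ j)%:E)%E.
      by rewrite normrM !gtr0_norm// exprMn EFinM.
    rewrite -ge0_integralZl//; last 2 first.
    - under eq_fun do rewrite nE -muleA; apply: measurable_funeM; exact: mWE.
    - by rewrite lee_fin exprn_ge0// ltW.
    apply: eq_integral => w _; rewrite nE -!EFinM; congr EFin.
    rewrite kE -exprM exprVn.
    by rewrite mulrA mulrA divff ?mul1r// expf_neq0// gt_eqF.
  have mWn n : measurable_fun setT (fun w => ((S w / c) ^+ n)%:E).
    exact/measurable_EFinP.
  have W0n n w : [set: T] w -> (0 <= ((S w / c) ^+ n)%:E)%E.
    by move=> _; rewrite lee_fin exprn_ge0// ltW.
  have r0 : (0 <= (e / rho ^+ 2)%:E)%E.
    by rewrite lee_fin divr_ge0 ?exprn_ge0// ltW.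
  have rW0 w : [set: T] w -> (0 <= (e / rho ^+ 2)%:E * ((S w / c) ^+ j.+1)%:E)%E.
    by move=> _; rewrite mule_ge0// W0n.
  have mrW : measurable_fun setT (fun w => (e / rho ^+ 2)%:E * ((S w / c) ^+ j.+1)%:E)%E.
    exact: measurable_funeM.
  rewrite -ge0_integralZl//; try exact: W0n.
  rewrite -ge0_integralD//; try exact: W0n.
  apply: ge0_le_integral => //.
  - by move=> w ?; rewrite adde_ge0 ?W0n ?rW0.
  - exact: emeasurable_funD.
  move=> w _; rewrite -EFinM -EFinD lee_fin.
  set W := S w / c; rewrite [leLHS](_ : _ = W ^+ j * (1 + e / rho ^+ 2 * W)); last first.
    by rewrite [W ^+ j.+1]exprS; ring.
  rewrite ler_wpM2l ?exprn_ge0 ?(ltW (W0 w))//.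
  apply: le_trans (expR_ge1Dx _); rewrite lerD2l [leRHS]mulrAC ler_wpM2r ?(ltW (W0 w))//.
  rewrite -subr_ge0 (_ : _ - _ = e ^+ 2 / (2 * rho ^+ 2)); last first.
    by rewrite /rho; field; rewrite gt_eqF.
  by apply: divr_ge0; [|apply: mulr_ge0 => //]; exact: sqr_ge0.
have Wj0 w : 0 <= (S w / c) ^+ j by rewrite exprn_ge0// ltW.
have Wj10 w : 0 <= (S w / c) ^+ j.+1 by rewrite exprn_ge0// ltW.
have MjE : (M j = (\int[P]_w (S w / c) ^+ j)%:E)%E by rewrite Rintegral_EFin.
have j1i : P.-integrable setT (EFin \o (fun w => (S w / c) ^+ j.+1)).
  apply: ge0_integrable => //; rewrite -/(M j.+1) ltNge leye_eq; apply/negP => /eqP Moo.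
  have := step 1 ltr01; by rewrite Moo MjE gt0_muley ?lte_fin ?divr_gt0 ?exprn_gt0//.
split => //; set A := \int[P]_w _.
have AE : M j.+1 = A%:E by rewrite /A Rintegral_EFin.
set B := \int[P]_w _ in jle.
have B0 : 0 <= B by exact: Rintegral_ge0.
suff AB : A <= (m + 2 * j)%:R * B.
  by rewrite coef_bS mulrC; apply: le_trans AB _; apply: ler_wpM2l.
apply: (@le_of_perturbed _ _ _ 0 (m + 2 * j + 2)) => e e0; rewrite mulr0 addr0.
have := step e e0; rewrite MjE AE -!EFinM -EFinD lee_fin -/B => st.
set rho := 1 + e in st *; have rho0 : 0 < rho by rewrite addr_gt0.
have bl := ler_wpM2r B0 (bernoulli_le (m + 2 * j) (ltW e0)).
rewrite -/rho in bl; have er : 0 < e / rho ^+ 2 by rewrite divr_gt0 ?exprn_gt0.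
rewrite -(ler_pM2l er) exprD.
set X := rho ^+ (m + 2 * j) in st bl *.
rewrite [leRHS](_ : _ = (m + 2 * j)%:R * e * X * B); last first.
  by field; rewrite gt_eqF.
lra.
Qed.

Lemma scaled_chi2_moment_le j :
  P.-integrable setT (EFin \o (fun w => S w ^+ j)) /\
  \int[P]_w S w ^+ j <= c ^+ j * coef_b R m j.
Proof.
have [ji jle] := scaled_chi2_moment j.
have SE w : S w ^+ j = c ^+ j * (S w / c) ^+ j.
  by rewrite -exprMn mulrCA divff ?mulr1// gt_eqF.
split; first by under eq_fun do rewrite SE; exact: (integrableZl measurableT _ ji).
under eq_Rintegral do rewrite SE.
by rewrite RintegralZl// ler_wpM2l// exprn_ge0// ltW.
Qed.
End chi2.

(** * Mean of a normal law *)

Section normal_mean.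
Context (R : realType) (m s : R).
Hypothesis s0 : s != 0.
Context d (T : measurableType d) (P : probability T R) (X : T -> R).
Hypotheses (mX : measurable_fun setT X)
  (lawX : forall A, measurable A -> P (X @^-1` A) = normal_prob m s A).

Lemma ge0_integral_normal_law (f : R -> \bar R) :
  measurable_fun setT f -> (forall x, 0 <= f x)%E ->
  (\int[P]_w f (X w) = \int[@lebesgue_measure R]_x (f x * (normal_pdf m s x)%:E))%E.
Proof.
move=> mf f0; apply: ge0_integral_law_density => //.
- exact: measurable_normal_pdf.
- exact: normal_pdf_ge0.
Qed.

Lemma normal_law_reflection (f : R -> \bar R) :
  measurable_fun setT f -> (forall x, 0 <= f x)%E ->
  (\int[P]_w f (X w) = \int[P]_w f (2 * m - X w)%R)%E.
Proof.
move=> mf f0.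
have mr : measurable_fun setT (fun x : R => 2 * m - x).
  by apply: measurable_funB => //.
rewrite (@ge0_integral_normal_law (fun x => f (2 * m - x)))//; last first.
  exact: (measurableT_comp mf).
have c0 : (-1 : R) != 0 by rewrite oppr_eq0 oner_eq0.
rewrite ge0_integral_normal_law//.
rewrite (@ge0_integral_affine _ (-1) (2 * m)
  (fun x => f x * (normal_pdf m s x)%:E)%E)//; last 2 first.
- apply: emeasurable_funM => //; apply/measurable_EFinP; exact: measurable_normal_pdf.
- by move=> x; rewrite mule_ge0// lee_fin normal_pdf_ge0.
rewrite normrN1 mul1e; apply: eq_integral => x _.
rewrite mulN1r [- x + _]addrC; congr (_ * _%:E)%E.
rewrite normal_pdfE//; congr (_ * _); rewrite /normal_fun; congr expR; congr (- _ / _).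
by ring.
Qed.

(** The contraction by 1/2 shows that the likelihood ratio, the exponential of a
    quadratic polynomial with positive leading coefficient, has a finite mean;
    it dominates |x|. *)
Lemma normal_law_integrable : P.-integrable setT (EFin \o X).
Proof.
(* From 3/4 x^2 - m x >= |x| - (1 + |m|)^2/3, by completing the square. *)
pose g x := (s ^+ 2 *+ 2) * normal_ratio m s (2^-1) x + (1 + `|m|) ^+ 2 / 3.
have mr := measurable_normal_ratio m s (2^-1).
have c0 : (2^-1 : R) != 0 by rewrite invr_eq0.
have ri : P.-integrable setT (EFin \o (fun w => normal_ratio m s (2^-1) (X w))).
  apply: ge0_integrable.
  - exact: (measurableT_comp mr).
  - by move=> w; exact: expR_ge0.
  rewrite (@ge0_integral_normal_law
    (fun x => (normal_ratio m s (2^-1) x)%:E)); last 2 first.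
  - exact/measurable_EFinP.
  - by move=> x; rewrite lee_fin expR_ge0.
  have := normal_prob_scaling m s0 c0 (@measurableT _ R).
  rewrite (@ge0_integral_density _ _ _ lebesgue_measure (normal_prob m s)
  (normal_pdf m s))//; last 4 first.
  - exact: measurable_normal_pdf.
  - exact: normal_pdf_ge0.
  - apply/measurable_EFinP; apply: measurable_funM => //.
    exact: measurable_indic_scale.
  - by move=> x; rewrite lee_fin mulr_ge0// expR_ge0.
  under eq_integral do rewrite indicT mul1r.
  move=> ->; rewrite (_ : normal_prob m s setT = 1%E); last exact: probability_setT.
  by rewrite mule1 ltry.
have gi : P.-integrable setT (EFin \o (fun w => g (X w))).
  apply: integrable_add; first exact: integrable_scale.
  exact: finite_measure_integrable_cst.
apply: integrable_le gi => // w; rewrite /g /normal_ratio; set x := X w.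
have s2 : 0 < s ^+ 2 *+ 2 by rewrite mulrn_wgt0// exprn_even_gt0.
have := expR_ge1Dx (- ((2^-1 * x - m) ^+ 2 - (x - m) ^+ 2) / (s ^+ 2 *+ 2)).
rewrite -(ler_pM2l s2) mulrDr mulr1 mulrCA divff ?gt_eqF// mulr1.
set E := expR _ => H.
have : x * m <= `|x| * `|m| by rewrite -normrM ler_norm.
have x2 : x ^+ 2 = `|x| ^+ 2 by rewrite real_normK// num_real.
have := sqr_ge0 (3 / 2 * `|x| - (1 + `|m|)).
move: H x2 s2; set a := `|x|; set b := `|m|; set S := s ^+ 2 *+ 2; nra.
Qed.

(** The reflection about m exchanges the positive and negative parts of X - m. *)
Lemma normal_law_mean : \int[P]_w X w = m.
Proof.
have Xi := normal_law_integrable.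
have ci (c : R) : P.-integrable setT (EFin \o cst c).
  exact: finite_measure_integrable_cst.
have ref : (\int[P]_w (Num.max (X w - m) 0)%:E = \int[P]_w (Num.max (m - X w) 0)%:E)%E.
  rewrite (@normal_law_reflection (fun x => (Num.max (x - m) 0)%:E)).
  - by apply: eq_integral => w _; congr (Num.max _ _)%:E; ring.
  - by apply/measurable_EFinP; apply: measurable_maxr => //; exact: measurable_funB.
  - by move=> x; rewrite lee_fin le_max lexx orbT.
have c1 : \int[P]_w cst m w = m by rewrite Rintegral_cst//= probability_setT mulr1.
apply/eqP; rewrite eq_le; apply/andP; split.
- rewrite -subr_ge0 -{1}c1 -RintegralB//.
  apply: Rintegral_ge0_parts; first exact: (integrableB measurableT (ci m) Xi).
  rewrite -ref; under eq_integral do rewrite opprB.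
  by [].
- rewrite -subr_ge0 -{1}c1 -RintegralB//.
  apply: Rintegral_ge0_parts; first exact: (integrableB measurableT Xi (ci m)).
  by rewrite ref; under eq_integral do rewrite opprB.
Qed.

End normal_mean.

(** * Independence *)

Lemma prod_measure_unique d1 d2 (T1 : measurableType d1) (T2 : measurableType d2)
    (R : realType) (m1 m2 : {measure set (T1 * T2) -> \bar R}) :
  (m1 setT < +oo)%E ->
  (forall A B, measurable A -> measurable B -> m1 (A `*` B) = m2 (A `*` B)) ->
  forall C, measurable C -> m1 C = m2 C.
Proof.
move=> m1oo m12.
apply: (measure_unique [set A `*` B | A in measurable & B in measurable]
  (fun=> setT)) => //.
- exact: measurable_prod_measurableType.
- move=> _ _ [A mA [B mB <-]] [A' mA' [B' mB' <-]].
  exists (A `&` A'); first exact: measurableI.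
  by exists (B `&` B'); [exact: measurableI|rewrite setXI].
- by move=> _; exists setT => //; exists setT => //; rewrite setXTT.
- by apply/seteqP; split => // x _; exists 0%N.
- by move=> _ [A mA [B mB <-]]; exact: m12.
Qed.

Section independence.
Context d d1 d2 (T : measurableType d) (T1 : measurableType d1)
  (T2 : measurableType d2) (R : realType) (P : probability T R).
Variables (X : {mfun T >-> T1}) (Y : {mfun T >-> T2}).
Hypothesis XY : forall A B, measurable A -> measurable B ->
  P (X @^-1` A `&` Y @^-1` B) = (P (X @^-1` A) * P (Y @^-1` B))%E.

Let mXY : measurable_fun setT (fun w => (X w, Y w)).
Proof. exact: measurable_fun_pair. Qed.

Lemma independent_joint_law C : measurable C ->
  (distribution P X \x distribution P Y)%E C = P ((fun w => (X w, Y w)) @^-1` C).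
Proof.
move=> mC; pose mXY' := isMeasurableFun.Build _ _ _ _ _ mXY.
pose XY' : {mfun T >-> (T1 * T2)%type} := HB.pack (fun w => (X w, Y w)) mXY'.
apply: (@product_measure_unique _ _ _ _ _ _ _ (distribution P XY')) => //.
Qed.

Lemma ge0_integral_independent (f : T1 * T2 -> \bar R) :
  measurable_fun setT f -> (forall z, 0 <= f z)%E ->
  (\int[P]_w f (X w, Y w) =
   \int[distribution P Y]_y \int[distribution P X]_x f (x, y))%E.
Proof.
move=> mf f0.
pose mXY' := isMeasurableFun.Build _ _ _ _ _ mXY.
pose XY' : {mfun T >-> (T1 * T2)%type} := HB.pack (fun w => (X w, Y w)) mXY'.
rewrite -(@fubini_tonelli2 _ _ _ _ _ (distribution P X) (distribution P Y))//.
transitivity (\int[distribution P XY']_z f z)%E.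
  by rewrite ge0_integral_distribution.
apply: eq_measure_integral => C mC _; apply/esym; exact: independent_joint_law.
Qed.

Lemma independent_mul (f : T1 -> R) (g : T2 -> R) :
  measurable_fun setT f -> measurable_fun setT g ->
  P.-integrable setT (EFin \o (f \o X)) -> P.-integrable setT (EFin \o (g \o Y)) ->
  P.-integrable setT (EFin \o (fun w => f (X w) * g (Y w))) /\
  \int[P]_w (f (X w) * g (Y w)) = \int[P]_w f (X w) * \int[P]_w g (Y w).
Proof.
move=> mf mg fi gi; pose h (z : T1 * T2) := f z.1 * g z.2.
have mh : measurable_fun setT h.
  apply: measurable_funM; first exact: (measurableT_comp mf).
  exact: (measurableT_comp mg).
have mhXY : measurable_fun setT (fun w => h (X w, Y w)) by exact: (measurableT_comp mh).
have hi : P.-integrable setT (EFin \o (fun w => f (X w) * g (Y w))).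
  apply/integrableP; split; first exact/measurable_EFinP.
  pose k (z : T1 * T2) := (`|f z.1|%:E * `|g z.2|%:E)%E.
  have -> : (\int[P]_w `|(EFin \o (fun w => f (X w) * g (Y w))%R) w| =
      \int[P]_w k (X w, Y w))%E.
    by apply: eq_integral => w _ /=; rewrite normrM EFinM.
  rewrite (@ge0_integral_independent k) /k/=.
  - have mfa : measurable_fun setT (fun x => `|f x|%:E).
      by apply/measurable_EFinP; exact: measurableT_comp.
    have mga : measurable_fun setT (fun x => `|g x|%:E).
      by apply/measurable_EFinP; exact: measurableT_comp.
    have fa0 x : [set: T1] x -> (0 <= `|f x|%:E)%E by rewrite lee_fin.
    have ga0 x : [set: T2] x -> (0 <= `|g x|%:E)%E by rewrite lee_fin.
    have ia0 : (0 <= \int[distribution P X]_x `|f x|%:E)%E by exact: integral_ge0.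
    under eq_integral do rewrite ge0_integralZr ?lee_fin//.
    rewrite ge0_integralZl//.
    rewrite (ge0_integral_distribution (X : {RV P >-> T1}) (f := fun x => `|f x|%:E))//.
    rewrite (ge0_integral_distribution (Y : {RV P >-> T2}) (f := fun x => `|g x|%:E))//.
    have /integrableP[_ foo] := fi; have /integrableP[_ goo] := gi.
    have fX0 : (0 <= \int[P]_x ((fun x => `|f x|%:E) \o X) x)%E.
      by apply: integral_ge0 => x _; rewrite /= lee_fin.
    apply: lte_mul_pinfty; [exact: fX0| |exact: goo].
    by rewrite ge0_fin_numE; [exact: foo|exact: fX0].
  - apply: emeasurable_funM; apply/measurable_EFinP.
      by apply: measurableT_comp => //; exact: (measurableT_comp mf).
    by apply: measurableT_comp => //; exact: (measurableT_comp mg).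
  - by move=> z; rewrite mule_ge0.
split => //.
pose mXY' := isMeasurableFun.Build _ _ _ _ _ mXY.
pose XY' : {mfun T >-> (T1 * T2)%type} := HB.pack (fun w => (X w, Y w)) mXY'.
have prodE (k : T1 * T2 -> \bar R) : (\int[distribution P XY']_z k z =
    \int[distribution P X \x distribution P Y]_z k z)%E.
  by apply: eq_measure_integral => C mC _; apply/esym; exact: independent_joint_law.
have hprod : (distribution P X \x distribution P Y)%E.-integrable setT (EFin \o h).
  apply/integrableP; split; first exact/measurable_EFinP.
  rewrite -prodE ge0_integral_distribution//; last first.
    by apply: measurableT_comp => //; exact/measurable_EFinP.
  by have /integrableP[] := hi.
apply: EFin_inj; rewrite Rintegral_EFin//.
transitivity (\int[distribution P XY']_z (h z)%:E)%E.
  by rewrite (integral_pushforward mXY)//; exact/measurable_EFinP.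
rewrite prodE -(integral21_prod_meas1 hprod) /fubini_G /h/=.
have fE : (\int[distribution P X]_x (f x)%:E = (\int[P]_w f (X w))%:E)%E.
  by rewrite Rintegral_EFin// integral_pushforward//; exact/measurable_EFinP.
have gE : (\int[distribution P Y]_x (g x)%:E = (\int[P]_w g (Y w))%:E)%E.
  by rewrite Rintegral_EFin// integral_pushforward//; exact/measurable_EFinP.
have fi' : (distribution P X).-integrable setT (EFin \o f).
  by apply: integrable_pushforward => //; exact/measurable_EFinP.
have gi' : (distribution P Y).-integrable setT (EFin \o g).
  by apply: integrable_pushforward => //; exact/measurable_EFinP.
under eq_integral => y _.
  under eq_integral do rewrite EFinM.
  rewrite integralZr// fE; over.
by rewrite integralZl// gE EFinM.
Qed.

End independence.

Section three.
Context d d1 d2 d3 (T : measurableType d) (T1 : measurableType d1)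
  (T2 : measurableType d2) (T3 : measurableType d3) (R : realType)
  (P : probability T R).
Variables (X : {mfun T >-> T1}) (Y : {mfun T >-> T2}) (W : {mfun T >-> T3}).
Hypothesis ind : mutually_independent3 (P := P) X Y W.

Let PT : P setT = 1%E. Proof. exact: probability_setT. Qed.

Lemma mutually_independent3_23 A B : measurable A -> measurable B ->
  P (Y @^-1` A `&` W @^-1` B) = (P (Y @^-1` A) * P (W @^-1` B))%E.
Proof.
move=> mA mB; have := ind (@measurableT _ _) mA mB.
by rewrite preimage_setT setTI PT mul1e.
Qed.

Let mYW : measurable_fun setT (fun w => (Y w, W w)).
Proof. exact: measurable_fun_pair. Qed.

(** For fixed A both sides are finite measures in C, and they agree on
    rectangles by mutual independence. *)
Lemma mutually_independent3_1_23 A C : measurable A -> measurable C ->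
  P (X @^-1` A `&` (fun w => (Y w, W w)) @^-1` C) =
  (P (X @^-1` A) * P ((fun w => (Y w, W w)) @^-1` C))%E.
Proof.
move=> mA mC.
have mXA : measurable (X @^-1` A).
  by rewrite -[X in measurable X]setTI; exact: measurable_funPT.
have mi : measurable_fun setT (\1_(X @^-1` A) : T -> R) by exact: measurable_indic.
have i0 w : 0 <= \1_(X @^-1` A) w :> R by [].
pose a : R := fine (P (X @^-1` A)).
have aE : P (X @^-1` A) = a%:E by rewrite fineK// fin_num_measure.
have a0 : 0 <= a by rewrite fine_ge0.
have [nu nuE] := weighted_pushforward P mi i0 mYW.
have [nu' nu'E] := weighted_pushforward P (@measurable_cst _ _ _ _ _ a) (fun=> a0) mYW.
have nuC D : measurable D -> nu D = P (X @^-1` A `&` (fun w => (Y w, W w)) @^-1` D).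
  move=> mD; rewrite -integral_indicT// nuE//; last first.
    by apply/measurable_EFinP; exact: measurable_indic.
  have mYD : measurable ((fun w => (Y w, W w)) @^-1` D).
    by rewrite -[X in measurable X]setTI; exact: mYW.
  rewrite -integral_indicT//; last exact: measurableI.
  by apply: eq_integral => w _; rewrite muleC -EFinM indicI.
have nu'C D : measurable D ->
    nu' D = (P (X @^-1` A) * P ((fun w => (Y w, W w)) @^-1` D))%E.
  move=> mD; rewrite -integral_indicT// nu'E//; last first.
    by apply/measurable_EFinP; exact: measurable_indic.
  have mYD : measurable ((fun w => (Y w, W w)) @^-1` D).
    by rewrite -[X in measurable X]setTI; exact: mYW.
  rewrite aE -(integral_indicT P mYD) -ge0_integralZl//.
  - by apply: eq_integral => w _; rewrite muleC.
  - by apply/measurable_EFinP; exact: measurable_indic.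
rewrite -nuC// -nu'C//; apply: prod_measure_unique mC.
  rewrite nuC//; apply: (@le_lt_trans _ _ 1%E); last exact: ltry.
  apply: probability_le1; apply: measurableI => //.
  by rewrite -[X in measurable X]setTI; exact: mYW.
move=> B D mB mD; rewrite nuC ?nu'C; try exact: measurableX.
have E : (fun w => (Y w, W w)) @^-1` (B `*` D) = Y @^-1` B `&` W @^-1` D by [].
by rewrite E mutually_independent3_23// muleA setIA; exact: ind.
Qed.

End three.

(** * The estimators *)

Section estimator.
Context d (T : measurableType d) (R : realType) (P : probability T R) (p : nat).
Variables (Z U : {RV P >-> p.-tuple R}) (S : {RV P >-> R}).
Variables (xi : 'rV[R]_p) (beta s2 t2 : R).
Hypotheses (s20 : 0 < s2) (t20 : 0 < t2) (ind : mutually_independent3 Z U S)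
  (lawZ : isotropic_normal Z (beta *: xi) t2) (lawU : isotropic_normal U xi s2).

Let US w := (U w, S w).

Lemma isotropic_normal_coord (X : {RV P >-> p.-tuple R}) (mu : 'rV[R]_p) (v : R) i :
  0 < v -> isotropic_normal X mu v ->
  P.-integrable setT (EFin \o (fun w => tnth (X w) i)) /\
  \int[P]_w tnth (X w) i = mu ord0 i.
Proof.
move=> v0 lawX; have s0 : Num.sqrt v != 0 by rewrite sqrtr_eq0 -ltNge.
have mX : measurable_fun setT (fun w => tnth (X w) i).
  exact: (measurableT_comp (measurable_tnth i)).
have law A : measurable A ->
    P ((fun w => tnth (X w) i) @^-1` A) = normal_prob (mu ord0 i) (Num.sqrt v) A.
  move=> mA; pose B j : set R := if j == i then A else setT.
  have mB j : measurable (B j) by rewrite /B; case: ifP.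
  have := lawX B mB.
  rewrite (bigD1 i)//= {2}/B eqxx big1 ?mule1; last first.
    by move=> j /negPf ji; rewrite /B ji; exact: (probability_setT (normal_prob _ _)).
  move=> <-; congr (P _); apply/seteqP; split => w /=.
    by move=> Aw j; rewrite /B; case: eqP => // ->.
  by move=> /(_ i); rewrite /B eqxx.
split; first exact: (normal_law_integrable s0 mX law).
exact: (normal_law_mean s0 mX law).
Qed.

(** Independence is applied to each coordinate Z_i separately, with the function
    U_i g(U, S) of the other two vectors. *)
Lemma dotp_mean (g : p.-tuple R * R -> R) : measurable_fun setT g ->
  (forall i, P.-integrable setT (EFin \o (fun w => tnth (U w) i * g (US w)))) ->
  P.-integrable setT (EFin \o (fun w => dotp (U w) (Z w) * g (US w))) /\
  \int[P]_w (dotp (U w) (Z w) * g (US w)) =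
    beta * \int[P]_w (inner xi (U w) * g (US w)).
Proof.
move=> mg gi.
have mUS : measurable_fun setT US by exact: measurable_fun_pair.
pose mUS' := isMeasurableFun.Build _ _ _ _ _ mUS.
pose US' : {mfun T >-> (p.-tuple R * R)%type} := HB.pack US mUS'.
have mul i := @independent_mul _ _ _ _ _ _ _ P Z US' (mutually_independent3_1_23 ind)
  (fun z => tnth z i) (fun z => tnth z.1 i * g z)
  (measurable_tnth i)
  (measurable_funM (measurableT_comp (measurable_tnth i) measurable_fst) mg)
  (isotropic_normal_coord i t20 lawZ).1 (gi i).
pose f i w := tnth (Z w) i * (tnth (U w) i * g (US w)).
have [fi fE] := Rintegral_sum (index_enum 'I_p) (f := f) (fun i => (mul i).1).
have [hi hE] := Rintegral_sum (index_enum 'I_p)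
  (f := fun i w => xi ord0 i * (tnth (U w) i * g (US w)))
  (fun i => integrable_scale _ (gi i)).
have dE w : dotp (U w) (Z w) * g (US w) = \sum_i f i w.
  by rewrite /dotp mulr_suml; apply: eq_bigr => i _; rewrite /f; ring.
have iE w : inner xi (U w) * g (US w) = \sum_i xi ord0 i * (tnth (U w) i * g (US w)).
  by rewrite /inner mulr_suml; apply: eq_bigr => i _; ring.
split; first by under eq_fun do rewrite dE.
under eq_Rintegral do rewrite dE.
under [in RHS]eq_Rintegral do rewrite iE.
rewrite fE hE mulr_sumr; apply: eq_bigr => i _.
rewrite (mul i).2 (isotropic_normal_coord i t20 lawZ).2 mxE RintegralZl//.
by rewrite mulrA.
Qed.

(** For fixed s the two parts are compared by reflection; Tonelli integrates the
    comparison over the law of S. *)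
Lemma even_inner_indep_ge0 (g : p.-tuple R * R -> R) :
  measurable_fun setT g -> (forall z, 0 <= g z) ->
  (forall u s, g (tscale (-1) u, s) = g (u, s)) ->
  P.-integrable setT (EFin \o (fun w => g (US w) * inner xi (U w))) ->
  0 <= \int[P]_w (g (US w) * inner xi (U w)).
Proof.
move=> mg g0 geven gi; apply: Rintegral_ge0_parts => //.
have max0 (x : R) : 0 <= Num.max x 0 by rewrite le_max lexx orbT.
pose F (h : R -> R) (z : p.-tuple R * R) := (g z * Num.max (h (inner xi z.1)) 0)%:E.
have mF h : measurable_fun setT h -> measurable_fun setT (F h).
  move=> mh; apply/measurable_EFinP; apply: measurable_funM => //.
  apply: measurable_maxr => //; apply: (measurableT_comp mh).
  exact: (measurableT_comp (measurable_inner xi) measurable_fst).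
have F0 h z : (0 <= F h z)%E by rewrite lee_fin mulr_ge0.
have FE h : measurable_fun setT h ->
    (forall w, g (US w) * h (inner xi (U w)) = h (g (US w) * inner xi (U w))) ->
  (\int[P]_w (Num.max (h (g (US w) * inner xi (U w))) 0)%:E =
   \int[distribution P S]_s \int[P]_w F h (U w, s))%E.
  move=> mh hE; transitivity (\int[P]_w F h (US w))%E.
    apply: eq_integral => w _; rewrite /F -hE.
    by rewrite -{1}(mulr0 (g (US w))) maxr_pMr.
  rewrite (@ge0_integral_independent _ _ _ _ _ _ _ P U S
    (mutually_independent3_23 ind) (F h))//; last exact: mF.
  apply: eq_integral => s _; rewrite ge0_integral_distribution//.
  exact: (measurableT_comp (mF h mh) (measurable_pair2 s)).
rewrite (FE (fun x => - x)); [|exact: oppr_measurable|by move=> w; rewrite mulrN].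
rewrite (FE id); [|exact: measurable_id|by []].
have mG h : measurable_fun setT h ->
    measurable_fun setT (fun s => \int[P]_w F h (U w, s))%E.
  move=> mh; have := measurable_fun_fubini_tonelli_G (m1 := distribution P U)
    (F h) (mF h mh) (F0 h).
  congr (measurable_fun _ _); apply/funext => s; rewrite /fubini_G.
  rewrite ge0_integral_distribution//.
  exact: (measurableT_comp (mF h mh) (measurable_pair2 s)).
apply: ge0_le_integral => //.
- by move=> s _; exact: integral_ge0.
- exact: (mG _ (oppr_measurable (D := setT) (R := R))).
- exact: (mG _ (@measurable_id _ R setT)).
move=> s _; apply: (normal_reflection_le s20 lawU (g := fun u => g (u, s))) => //.
exact: (measurableT_comp mg (measurable_pair2 s)).
Qed.

End estimator.

Section bias.
Context d (T : measurableType d) (R : realType) (P : probability T R) (p m l : nat).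
Variables (Z U : {RV P >-> p.-tuple R}) (S : {RV P >-> R}).
Variables (xi : 'rV[R]_p) (beta s2 t2 : R) (phi : R -> R).
Hypotheses (s20 : 0 < s2) (t20 : 0 < t2) (ind : mutually_independent3 Z U S)
  (lawZ : isotropic_normal Z (beta *: xi) t2) (lawU : isotropic_normal U xi s2)
  (lawS : scaled_chi2 S s2 m) (S0 : forall w, 0 < S w) (m0 : (0 < m)%N)
  (lp : (l.+1.*2 < p)%N).
Hypotheses (mphi : measurable_fun (`]0, +oo[%classic : set R) phi)
  (phi_le : forall t : R, 0 < t -> 0 <= phi t <=
       2 * \sum_(1 <= j < l.+1) coef_a R p j / coef_b R m j * t ^- j).

Let US w := (U w, S w).
Let q k w := invpow 0 k (U w).
Let coef j : R := coef_a R p j.+1 / coef_b R m j.+1.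
Let bound (t : R) : R := 2 * \sum_(j < l) coef j * t ^- j.+1.
(* phit and ratio are total, measurable and nonnegative versions of phi and of
   |u|^2/s. At t = 0 the inverse powers vanish by convention, so that phit is
   at most bound there too. *)
Let phit : R -> R := phi \_ `]0, +oo[.
Let ratio (z : p.-tuple R * R) : R := sqnorm z.1 / Num.max z.2 0.

Let coef_ge0 (j : 'I_l) : 0 <= coef j.
Proof.
rewrite divr_ge0 ?coef_a_ge0 ?(ltW (coef_b_gt0 _ _ _))//.
by rewrite ltnW// (leq_ltn_trans _ lp)// leq_double ltnS ltnW.
Qed.

Let bound_ge0 t : 0 <= t -> 0 <= bound t.
Proof.
move=> t0; rewrite mulr_ge0// sumr_ge0// => j _.
by rewrite mulr_ge0// invr_ge0 exprn_ge0.
Qed.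

Let phit_ge0 t : 0 <= phit t.
Proof.
rewrite /phit patchE; case: ifPn => //; rewrite mem_setE in_itv/= andbT => t0.
by have /andP[] := phi_le t0.
Qed.

Let phit_le t : 0 <= t -> phit t <= bound t.
Proof.
move=> t0; rewrite /phit patchE; case: ifPn => [|_]; last exact: bound_ge0.
rewrite mem_setE in_itv/= andbT => {}t0.
have /andP[_] := phi_le t0; rewrite big_add1/= big_mkord.
by congr (_ <= _ * _); apply: eq_bigr.
Qed.

Let ratio_ge0 z : 0 <= ratio z.
Proof. by rewrite divr_ge0 ?sqnorm_ge0// le_max lexx orbT. Qed.

Let measurable_ratio : measurable_fun setT ratio.
Proof.
apply: measurable_funM.
  exact: (measurableT_comp (@measurable_sqnorm R p) measurable_fst).
apply: measurable_inv_ge0; last by move=> z; rewrite le_max lexx orbT.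
exact: (measurable_maxr measurable_snd (measurable_cst _)).
Qed.

Let measurable_phit : measurable_fun setT (phit \o ratio).
Proof.
have mi : measurable (`]0, +oo[%classic : set R) by exact: measurable_itv.
have mp : measurable_fun setT phit by apply/(measurable_restrictT _ mi).
exact: (measurableT_comp mp measurable_ratio).
Qed.

Let measurable_bound : measurable_fun setT (bound \o ratio).
Proof.
apply: measurable_funM => //; apply: measurable_sum => j; apply: measurable_funM => //.
apply: measurable_inv_ge0; last by move=> z; rewrite exprn_ge0.
exact: measurable_funX.
Qed.

Let ratioE w : ratio (US w) = sqnorm (U w) / S w.
Proof. by rewrite /ratio/= max_l// ltW. Qed.

Let q_ge0 k w : 0 <= q k w.
Proof. exact: invpow_ge0. Qed.

Let qi k : (k.*2 < p)%N -> P.-integrable setT (EFin \o q k).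
Proof. exact: (invpow_integrable s20 lawU). Qed.

Let mU (h : p.-tuple R -> R) : measurable_fun setT h -> measurable_fun setT (h \o U).
Proof. by move=> mh; exact: (measurableT_comp mh). Qed.

Let mUS (h : p.-tuple R * R -> R) :
  measurable_fun setT h -> measurable_fun setT (h \o US).
Proof. by move=> mh; apply: (measurableT_comp mh); exact: measurable_fun_pair. Qed.

Let q_dominated k (h : p.-tuple R -> R) (C : R) : (k.+1.*2 < p)%N ->
  measurable_fun setT h -> (forall u, `|h u| <= C + sqnorm u) ->
  P.-integrable setT (EFin \o (fun w => q k.+1 w * h (U w))).
Proof.
move=> kp mh hC.
apply: (invpow_dominated_integrable (lexx 0) (mU mh) (fun w => hC (U w)) (qi kp)).
Qed.

Let bound_qE w (x : R) : bound (ratio (US w)) * q 1 w * x =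
  \sum_(j < l) (2 * coef j) * ((q j.+2 w * x) * S w ^+ j.+1).
Proof.
rewrite ratioE /bound /q /invpow addr0; move: (sqnorm (U w)) => N.
rewrite mulr_sumr !mulr_suml; apply: eq_bigr => j _.
by rewrite expr1 exprMn invfM !exprVn invrK (exprS _ j.+1) invfM; ring.
Qed.

Let S_moment j : P.-integrable setT (EFin \o (fun w => S w ^+ j)) /\
  \int[P]_w S w ^+ j <= s2 ^+ j * coef_b R m j.
Proof. exact: scaled_chi2_moment_le. Qed.

Let bound_integral (h : p.-tuple R -> R) (C : R) :
  measurable_fun setT h -> (forall u, `|h u| <= C + sqnorm u) ->
  P.-integrable setT (EFin \o (fun w => bound (ratio (US w)) * q 1 w * h (U w))) /\
  \int[P]_w (bound (ratio (US w)) * q 1 w * h (U w)) =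
  \sum_(j < l) (2 * coef j) *
    (\int[P]_w (q j.+2 w * h (U w)) * \int[P]_w S w ^+ j.+1).
Proof.
move=> mh hC.
have jp (j : 'I_l) : (j.+2.*2 < p)%N by rewrite (leq_ltn_trans _ lp)// leq_double ltnS.
have mul (j : 'I_l) := @independent_mul _ _ _ _ _ _ _ P U S (mutually_independent3_23 ind)
  (fun u => invpow 0 j.+2 u * h u) (fun s => s ^+ j.+1)
  (measurable_funM (measurable_invpow (p := p) j.+2 (lexx 0)) mh)
  (measurable_funX j.+1 (@measurable_id _ R setT))
  (q_dominated (jp j) mh hC) (S_moment j.+1).1.
have [si sE] := Rintegral_sum (index_enum 'I_l)
  (f := fun (j : 'I_l) w => (2 * coef j) * ((q j.+2 w * h (U w)) * S w ^+ j.+1))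
  (fun j => integrable_scale _ (mul j).1).
split; first by under eq_fun do rewrite bound_qE.
under eq_Rintegral do rewrite bound_qE.
rewrite sE; apply: eq_bigr => j _; rewrite RintegralZl//; last exact: (mul j).1.
by rewrite (mul j).2.
Qed.

Let phit_integrable (h : p.-tuple R -> R) (C : R) :
  measurable_fun setT h -> (forall u, `|h u| <= C + sqnorm u) ->
  P.-integrable setT (EFin \o (fun w => phit (ratio (US w)) * q 1 w * h (U w))).
Proof.
move=> mh hC.
have mah : measurable_fun setT (fun u => `|h u|) by exact: measurableT_comp.
have hC' u : `| `|h u| | <= C + sqnorm u by rewrite normr_id.
apply: integrable_le (bound_integral mah hC').1.
  apply: measurable_funM; last exact: mU.
  apply: measurable_funM; first exact: (mUS measurable_phit).
  exact: (mU (measurable_invpow 1 (lexx 0))).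
move=> w; rewrite !normrM (ger0_norm (q_ge0 _ _)) (ger0_norm (phit_ge0 _)).
by rewrite ler_wpM2r// ler_wpM2r// phit_le.
Qed.

Let measurable_q1 : measurable_fun setT (fun z : p.-tuple R * R => invpow 0 1 z.1).
Proof. exact: (measurableT_comp (measurable_invpow 1 (lexx 0)) measurable_fst). Qed.

Let p2 : (1.*2 < p)%N.
Proof. by rewrite (leq_ltn_trans _ lp)// leq_double. Qed.

Let coord_bound i (u : p.-tuple R) : `|tnth u i| <= 1 + sqnorm u.
Proof.
rewrite /sqnorm /dotp (bigD1 i)//= addrA -[leLHS]addr0 lerD//; last first.
  by apply: sumr_ge0 => j _; rewrite -expr2 sqr_ge0.
rewrite -expr2 -(real_normK (num_real (tnth u i))).
by have := normr_ge0 (tnth u i); set x := `|_|; nra.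
Qed.

Lemma beta_LS_mean : P.-integrable setT (EFin \o beta_LS Z U) /\
  \int[P]_w beta_LS Z U w = beta * \int[P]_w (q 1 w * inner xi (U w)).
Proof.
have gi i : P.-integrable setT (EFin \o (fun w => tnth (U w) i * invpow 0 1 (US w).1)).
  under eq_fun do rewrite mulrC.
  exact: (q_dominated p2 (measurable_tnth i) (coord_bound i)).
have [di dE] := dotp_mean t20 ind lawZ measurable_q1 gi.
have -> : beta_LS Z U = fun w => dotp (U w) (Z w) * invpow 0 1 (US w).1.
  by apply/funext => w; rewrite /invpow addr0.
by split=> //; rewrite dE; under eq_Rintegral do rewrite mulrC.
Qed.

(** The estimator is [dotp] times a function of (U, S). Where U = 0 both vanish,
    as 1/0 = 0; elsewhere the argument of phi is positive and phit agrees with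
    phi there. *)
Lemma beta_phi_mean : P.-integrable setT (EFin \o beta_phi phi Z U S) /\
  \int[P]_w beta_phi phi Z U S w = beta * (\int[P]_w (q 1 w * inner xi (U w)) +
    \int[P]_w (phit (ratio (US w)) * q 1 w * inner xi (U w))).
Proof.
pose g z := (1 + phit (ratio z)) * invpow 0 1 z.1.
have mg : measurable_fun setT g.
  by apply: measurable_funM => //; apply: measurable_funD => //; exact: measurable_phit.
have gi i : P.-integrable setT (EFin \o (fun w => tnth (U w) i * g (US w))).
  rewrite (_ : (fun w => _) = fun w =>
      q 1 w * tnth (U w) i + phit (ratio (US w)) * q 1 w * tnth (U w) i).
    apply: integrable_add.
      exact: (q_dominated p2 (measurable_tnth i) (coord_bound i)).
    exact: (phit_integrable (measurable_tnth i) (coord_bound i)).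
  by apply/funext => w; rewrite /g /q/=; ring.
have [di dE] := dotp_mean t20 ind lawZ mg gi.
have -> : beta_phi phi Z U S = fun w => dotp (U w) (Z w) * g (US w).
  apply/funext => w; rewrite /beta_phi /beta_LS /g/= ratioE /invpow addr0 expr1.
  have [->|N0] := eqVneq (sqnorm (U w)) 0; first by rewrite invr0 !mulr0.
  have t0 : 0 < sqnorm (U w) / S w.
    by rewrite divr_gt0// lt_neqAle eq_sym N0 sqnorm_ge0.
  rewrite /phit patchE mem_setE in_itv/= t0/=; ring.
split=> //; rewrite dE -RintegralD//; last 2 first.
- exact: (q_dominated p2 (measurable_inner xi) (inner_bound xi)).
- exact: (phit_integrable (measurable_inner xi) (inner_bound xi)).
by congr (_ * _); apply: eq_Rintegral => w _; rewrite /g /q/=; ring.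
Qed.

(** The lower bound and the replacement of phi by its bound are the reflection
    inequality for phi/N and for (bound - phi)/N; after independence and the
    moments of S, the telescoping sum remains. *)
Lemma correction_bounds :
  0 <= \int[P]_w (phit (ratio (US w)) * q 1 w * inner xi (U w)) <=
  2 * (1 - \int[P]_w (q 1 w * inner xi (U w))).
Proof.
have even (f : R -> R) u s : f (ratio (tscale (-1) u, s)) * invpow 0 1 (tscale (-1) u) =
    f (ratio (u, s)) * invpow 0 1 u.
  by rewrite /ratio invpow_even/= sqnorm_scale sqrrN expr1n mul1r.
have phi_i := phit_integrable (measurable_inner xi) (inner_bound xi).
have [bi bE] := bound_integral (measurable_inner xi) (inner_bound xi).
apply/andP; split.
  apply: (even_inner_indep_ge0 s20 ind lawU
    (g := fun z => phit (ratio z) * invpow 0 1 z.1)) => //.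
  - by apply: measurable_funM => //; exact: measurable_phit.
  - by move=> z; rewrite mulr_ge0// invpow_ge0.
apply: (@le_trans _ _ (\int[P]_w (bound (ratio (US w)) * q 1 w * inner xi (U w)))).
  rewrite -subr_ge0 -RintegralB//.
  rewrite (_ : \int[P]_w _ = \int[P]_w ((bound (ratio (US w)) - phit (ratio (US w))) *
      q 1 w * inner xi (U w))); last first.
    by apply: eq_Rintegral => w _; ring.
  apply: (even_inner_indep_ge0 s20 ind lawU
    (g := fun z => (bound (ratio z) - phit (ratio z)) * invpow 0 1 z.1)) => //.
  - apply: measurable_funM => //; apply: measurable_funB.
      exact: measurable_bound.
    exact: measurable_phit.
  - by move=> z; rewrite mulr_ge0 ?invpow_ge0// subr_ge0 phit_le.
  - by move=> u s; exact: (even (fun t => bound t - phit t)).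
  - rewrite (_ : (fun w => _) = fun w => bound (ratio (US w)) * q 1 w * inner xi (U w)
        - phit (ratio (US w)) * q 1 w * inner xi (U w)).
      exact: (integrableB measurableT bi phi_i).
    by apply/funext => w; rewrite /q/=; ring.
have := stein_sum_le s20 lawU lp; rewrite big_add1/= big_mkord bE => H.
apply: (@le_trans _ _ (2 * \sum_(j < l) coef_a R p j.+1 * s2 ^+ j.+1 *
    \int[P]_w (q j.+2 w * inner xi (U w)))); last first.
  by rewrite ler_wpM2l// lerBrDl.
rewrite mulr_sumr; apply: ler_sum => j _.
have jp : (j.+2.*2 < p)%N by rewrite (leq_ltn_trans _ lp)// leq_double ltnS.
have h0 := inner_invpow_ge0 s20 lawU (lexx 0) (qi jp).
have [_ Sle] := S_moment j.+1.
rewrite -[leLHS]mulrA ler_wpM2l// [leRHS](_ : _ = coef j *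
  (\int[P]_w (q j.+2 w * inner xi (U w)) * (s2 ^+ j.+1 * coef_b R m j.+1))).
  by rewrite ler_wpM2l// ler_wpM2l.
by rewrite /coef; field; rewrite gt_eqF// coef_b_gt0.
Qed.

End bias.

Theorem theorem3p1 (R : realType)
    (n r p m : nat) (hn : (2 <= n)%N) (hr : (2 <= r)%N)
    (hp : p = (n - 1)%N) (hm : m = (n * (r - 1))%N) (hp5 : (5 <= p)%N)
    (l : nat) (hl1 : (1 <= l)%N) (hl : l%:R < (p%:R - 2) / 2 :> R)
    (phi : R -> R) (mphi : measurable_fun (`]0, +oo[%classic : set R) phi)
    (hphi : forall t : R, 0 < t ->
       0 <= phi t <=
       2 * \sum_(1 <= j < l.+1) coef_a R p j / coef_b R m j * t ^- j)
    (d : measure_display) (T : measurableType d) (P : probability T R)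
    (Z U : {RV P >-> p.-tuple R}) (S : {RV P >-> R})
    (hS : forall w : T, 0 < S w)
    (beta sigma2 tau2 : R) (xi : 'rV[R]_p)
    (hxi : xi != 0) (hsigma : 0 < sigma2) (htau : 0 < tau2)
    (hind : mutually_independent3 Z U S)
    (lawZ : isotropic_normal Z (beta *: xi) tau2)
    (lawU : isotropic_normal U xi sigma2)
    (lawS : scaled_chi2 S sigma2 m) :
  [/\ P.-integrable setT (EFin \o beta_LS Z U),
      P.-integrable setT (EFin \o beta_phi phi Z U S) &
      (`|Bias P (beta_phi phi Z U S) beta| <=
       `|Bias P (beta_LS Z U) beta|)%E].
Proof.
have m0 : (0 < m)%N by rewrite hm muln_gt0 subn_gt0 hr (leq_trans _ hn).
have lp : (l.+1.*2 < p)%N.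
  rewrite -(ltr_nat R) -muln2 natrM -natr1; move: hl; lra.
have [LSi LSe] := beta_LS_mean hsigma htau hind lawZ lawU lp.
have [phii phie] := beta_phi_mean hsigma htau hind lawZ lawU lawS hS m0 lp mphi hphi.
have := correction_bounds hsigma hind lawU lawS hS m0 lp mphi hphi.
split=> //; rewrite /Bias unlock -!Rintegral_EFin// LSe phie.
set h := \int[P]_w _; set x := \int[P]_w _ in H *.
rewrite -/h in H; case/andP: H => x0 xh.
rewrite -!EFinB !abse_EFin lee_fin.
rewrite (_ : beta * (h + x) - beta = beta * (x - (1 - h))); last by ring.
rewrite (_ : beta * h - beta = beta * (h - 1)); last by ring.
rewrite !normrM ler_wpM2l// [leRHS]distrC [leRHS]ger0_norm; last lra.
by rewrite ler_norml; apply/andP; split; lra.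
Qed.
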